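(* For an odd positive integer $n$, let $s_n$ denote the number of ordered pairs $(\pi_1,\pi_2)$ of bijections $\pi_1,\pi_2\colon\{1,\dots,n\}\to\mathbb{Z}/n\mathbb{Z}$ such that the pointwise sum $\pi_1+\pi_2\colon\{1,\dots,n\}\to\mathbb{Z}/n\mathbb{Z}$, $i\mapsto\pi_1(i)+\pi_2(i)$, is also a bijection. Then, as $n\to\infty$ through odd integers, \[ s_n=\bigl(e^{-1/2}+o(1)\bigr)\frac{n!^3}{n^{n-1}}. \] *)

(* Defs.v *)
From mathcomp Require Import all_boot all_order all_algebra.
From mathcomp Require Import boolp.

Set Implicit Arguments.
Unset Strict Implicit.
Unset Printing Implicit Defensive.

Import GRing.Theory.
Local Open Scope ring_scope.

(* For n > 0 this is 'I_n with addition modulo n; unlike 'Z_n, it has exactly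
   n elements also when n = 1. *)
Notation Zmodn n := 'I_n.-1.+1.

(* The index set {1, ..., n} is represented by 'I_n. *)
Definition sum_pairs (n : nat) :
    {set {ffun 'I_n -> Zmodn n} * {ffun 'I_n -> Zmodn n}} :=
  [set p : {ffun 'I_n -> Zmodn n} * {ffun 'I_n -> Zmodn n} |
    [&& `[< bijective p.1 >], `[< bijective p.2 >]
      & `[< bijective (fun i => p.1 i + p.2 i) >]]].

Definition s (n : nat) : nat := #|sum_pairs n|.

(* Main.v *)
(** Let [f(chi)], for [chi] in [(Z/n)^n], be the average over the bijections
    [sigma] of the character [x |-> e(sum_i chi_i x_i / n)].  By Fourier inversion
    [n^n s_n = n!^3 sum_chi f(chi)^3], and since [n] is odd [f] is unchanged when
    a constant is added to [chi]; so it suffices to sum over the [chi] with few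
    non-zero entries, times [n], and to show that every [chi] without a value of
    large multiplicity is negligible.

    Writing [n!/prod_c r_c! * f(chi)], with [r_c] the multiplicity of [c] in [chi],
    as a coefficient of [prod_g sum_c x_c e(cg/n)], the choice [|x_c|^2 = r_c/n]
    and AM-GM give [|f(chi)| <= n^(n/2)/n! prod_c r_c!/r_c^(r_c/2)].  A generating
    function over the types [r] then makes [sum |f|^3] over the [chi] with no
    majority value bounded.  For [m] non-zero entries, with [m <= eps n], either
    some non-zero value takes most of them, and there are few such types, or the
    pointwise bound gains a factor [exp(-delta m)] over the reciprocal of
    [sum_{weight m} f^2 ~ (e n/m)^(m/2)], which is estimated by Parseval with noise;
    either way the level [m] contributes at most [B t^m] with [t < 1].  Finally,
    for fixed [m] the sum [T_m] of [f^3] over weight [m] satisfies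
    [m T_m = - T_{m-2} + O(n^(-1/2))], because summing out one coordinate merges
    two frequencies and only cancelling pairs matter.  Hence [T_{2j}] tends to
    [(-1/2)^j/j!], [T_{2j+1}] to [0], and dominated convergence gives [e^(-1/2)]. *)

Require Import Defs.
From mathcomp Require Import all_boot all_order all_fingroup all_algebra.
From mathcomp Require Import ring lra zify.
From mathcomp Require Import cyclic separable cyclotomic complex.
From mathcomp Require Import all_classical all_reals all_analysis.
Set Implicit Arguments. Unset Strict Implicit. Unset Printing Implicit Defensive.
Import Order.TTheory GRing.Theory Num.Theory.
Import numFieldNormedType.Exports.
Local Open Scope ring_scope.

(** * Characters of Z/n *)

(** After normalisation the sum of f^3 is divided by n, and the n shifts of the sparse frequencies
    compensate exactly this division. For the frequencies without a majority value a bound O(1)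
    without any decay therefore suffices, but an exponential loss is not affordable, so the
    parameter of the generating function has to be matched to Stirling's formula. On the level m,
    the product of the supremum of |f| with the sum of f^2 is the natural bound, and it is just not
    good enough: if one non-zero value takes all m entries, the bound on |f| is about (m/(e
    n))^(m/2), essentially the reciprocal of the Parseval bound, and no decay in m is left. This is
    the reason for the division according to whether some non-zero value takes more than 3/4 of the
    m entries. If none does, the product gains sqrt(3/4)^m up to a polynomial in m. If one does,
    Parseval is given up and the types are counted; this costs about n^2, which is recovered from a
    small base to the power m once m is at least 8. *)

Lemma prim_root_exists (C : numClosedFieldType) (n : nat) :
  (0 < n)%N -> {z : C | n.-primitive_root z}.
Proof.
move=> n_gt0; apply/sigW.
have [rs] := closed_field_poly_normal ('X^n - 1 : {poly C}).
rewrite (monicP (monicXnsubC 1 n_gt0)) scale1r => rsE.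
have /hasP[z _ z_prim] : has n.-primitive_root rs; last by exists z.
apply: has_prim_root => //.
- by apply/allP => z; rewrite -root_prod_XsubC -rsE.
- by rewrite -separable_prod_XsubC -rsE separable_Xn_sub_1 // pnatr_eq0 -lt0n.
by rewrite -ltnS -(size_prod_XsubC rs id) -rsE size_XnsubC.
Qed.

Section Characters.
Variables (C : numClosedFieldType) (k : nat).
Local Notation n := k.+1.

Definition omega : C := sval (prim_root_exists C (ltn0Sn k)).

Lemma omegaP : n.-primitive_root omega.
Proof. exact: (svalP (prim_root_exists C (ltn0Sn k))). Qed.

Definition echar (a b : 'I_n) : C := omega ^+ (a * b).

Lemma omega_mod m : omega ^+ (m %% n) = omega ^+ m.
Proof. exact: expr_mod (prim_expr_order omegaP). Qed.

Lemma norm_prim_root m (z : C) : m.-primitive_root z -> `|z| = 1.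
Proof.
move=> hz; have m_gt0 := prim_order_gt0 hz.
have h1 : `|z| ^+ m = 1 by rewrite -normrX (prim_expr_order hz) normr1.
by apply/eqP; rewrite -(@pexpr_eq1 _ _ m) ?normr_ge0 // h1.
Qed.

Lemma echarC a b : echar a b = echar b a.
Proof. by rewrite /echar mulnC. Qed.

Lemma echarDl a a' b : echar (a + a') b = echar a b * echar a' b.
Proof.
rewrite /echar /= -exprD -mulnDl -[LHS]omega_mod modnMml.
by rewrite omega_mod.
Qed.

Lemma echar0 b : echar 0 b = 1.
Proof. by rewrite /echar mul0n expr0. Qed.

Lemma norm_echar a b : `|echar a b| = 1.
Proof. by rewrite normrX (norm_prim_root omegaP) expr1n. Qed.

Lemma echar_neq0 a b : echar a b != 0.
Proof. by rewrite -normr_eq0 norm_echar oner_eq0. Qed.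

Lemma echarNl a b : echar (- a) b = (echar a b)^-1.
Proof.
apply: (mulfI (echar_neq0 a b)).
by rewrite -echarDl subrr echar0 divff ?echar_neq0.
Qed.

Lemma conj_echar a b : (echar a b)^* = echar (- a) b.
Proof. by rewrite echarNl invC_norm norm_echar expr1n invr1 mul1r. Qed.

Lemma echarDr a b b' : echar a (b + b') = echar a b * echar a b'.
Proof. by rewrite echarC echarDl !(echarC a). Qed.

Lemma echarNr a b : echar a (- b) = echar (- a) b.
Proof. by rewrite echarC !echarNl echarC. Qed.

Lemma echar_eq1 a : (forall b, echar a b = 1) -> a = 0.
Proof.
case: (posnP k) => [k0|k_gt0] h.
  by apply/val_inj; case: a {h} => -[|m] //=; rewrite k0.
have := h (Ordinal (k_gt0 : (1 < n)%N)); rewrite /echar /= muln1 => h1.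
have : (n %| a)%N by rewrite (prim_order_dvd omegaP) h1.
by rewrite /dvdn modn_small // => /eqP ha; apply/val_inj.
Qed.

Lemma sum_echar a : \sum_b echar a b = n%:R * (a == 0)%:R.
Proof.
have [->|a_neq0] := eqVneq a 0.
  by rewrite (eq_bigr (fun=> 1)) ?sumr_const ?card_ord ?mulr1 // => b _; rewrite echar0.
rewrite mulr0; apply/eqP.
have [b hb] : exists b, echar a b != 1.
  apply/existsP; apply: contraNT a_neq0; rewrite negb_exists => /forallP h.
  by apply/eqP/echar_eq1 => b; apply/eqP; have := h b; rewrite negbK.
have : echar a b * (\sum_b echar a b) = \sum_b echar a b.
  rewrite big_distrr /= [RHS](reindex_inj (addrI b)) /=.
  by apply: eq_bigr => b' _; rewrite echarDr.
move/eqP; rewrite -subr_eq0 -{2}[\sum__ _]mul1r -mulrBl mulf_eq0 subr_eq0.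
by rewrite (negbTE hb).
Qed.

End Characters.

(** * Fourier coefficients of the set of bijections *)

Section Coefficients.
Variables (R : realType) (k : nat).
Local Notation n := k.+1.
Local Notation C := (R[i]).
Local Notation freq := {ffun 'I_n -> 'I_n}.

(* [charsum / n!] is the Fourier transform of the uniform measure on the
   bijections; it is real because negation permutes the bijections. *)
Definition charsum (chi : freq) : C :=
  \sum_(sigma : {perm 'I_n}) \prod_i echar C (chi i) (sigma i).

Definition fhat (chi : freq) : R := complex.Re (charsum chi) / (n`!)%:R.

Lemma factR_neq0 (K : numFieldType) m : (m`!)%:R != 0 :> K.
Proof. by rewrite pnatr_eq0 -lt0n fact_gt0. Qed.

Lemma charsum_conj chi : (charsum chi)^*%R = charsum chi.
Proof.
rewrite /charsum rmorph_sum /=.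
pose negp : {perm 'I_n} := perm (@oppr_inj 'I_n).
rewrite (reindex_inj (mulIg negp)) /=; apply: eq_bigr => sigma _.
rewrite rmorph_prod; apply: eq_bigr => i _.
by rewrite permM permE [LHS]conj_echar echarNr opprK.
Qed.

Lemma charsumE chi : charsum chi = real_complex R ((n`!)%:R * fhat chi).
Proof.
rewrite /fhat mulrC divfK ?factR_neq0 // RRe_real //.
by apply/CrealP; exact: charsum_conj.
Qed.

Lemma sum_freq_prod (y : 'I_n -> 'I_n) :
  \sum_(chi : freq) \prod_i echar C (chi i) (y i) =
  n%:R ^+ n * [forall i, y i == 0]%:R.
Proof.
rewrite -(bigA_distr_bigA (fun i c => echar C c (y i))).
under eq_bigr => i _ do rewrite (eq_bigr _ (fun c _ => echarC C c (y i))) sum_echar.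
rewrite big_split /= prodr_const card_ord; congr (_ * _).
case: forallP => [h|h].
  by rewrite big1 // => i _; rewrite h.
move/forallP: h; rewrite negb_forall => /existsP[i hi].
by apply/eqP/prodf_eq0; exists i => //; rewrite (negbTE hi).
Qed.

Lemma card_sum_pairs : s n =
  #|[set p : {perm 'I_n} * {perm 'I_n} | injectiveb (fun i => p.1 i + p.2 i : 'I_n)]|.
Proof.
rewrite /s; symmetry.
pose h (p : {perm 'I_n} * {perm 'I_n}) : freq * freq :=
  ([ffun i => p.1 i], [ffun i => p.2 i]).
have h_inj : injective h.
  move=> [s1 t1] [s2 t2] [/ffunP hs /ffunP ht].
  by congr (_, _); apply/permP => i; [have := hs i|have := ht i]; rewrite !ffunE.
rewrite -(card_imset _ h_inj); apply: eq_card => -[x y].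
rewrite /sum_pairs inE /=; apply/imsetP/and3P.
  move=> [[u v] huv [-> ->]]; rewrite inE /= in huv.
  have bij_of (z : freq) (p : {perm 'I_n}) : (forall i, z i = p i) -> `[<bijective z>].
    move=> hz; apply/asboolP/injF_bij => i j; rewrite !hz; exact: perm_inj.
  split; [apply: (bij_of _ u)|apply: (bij_of _ v)|]; try by move=> i; rewrite ffunE.
  apply/asboolP/injF_bij => i j; rewrite !ffunE => hij.
  by move/injectiveP: huv; apply.
move=> [/asboolP hx /asboolP hy /asboolP hxy].
exists (perm (bij_inj hx), perm (bij_inj hy)).
  rewrite inE /=; apply/injectiveP => i j /=; rewrite !permE; exact: bij_inj hxy _ _.
by congr (_, _); apply/ffunP => i; rewrite ffunE permE.
Qed.

(** Negation preserves bijectivity, so a third bijection [c] exists exactly when [a + b] is a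
    bijection, and it is then forced. In this symmetric form the condition is a vanishing sum, which
    orthogonality of characters detects. *)
Lemma sum_zero_triples :
  (\sum_(a : {perm 'I_n}) \sum_(b : {perm 'I_n}) \sum_(c : {perm 'I_n})
     [forall i, (a i + b i + c i == 0 :> 'I_n)%R] = s n)%N.
Proof.
rewrite card_sum_pairs -sum1_card [RHS]big_mkcond /=.
rewrite (pair_bigA _ (fun a b : {perm 'I_n} => \sum_(c : {perm 'I_n})
     nat_of_bool [forall i, (a i + b i + c i == 0 :> 'I_n)%R]))%N.
apply: eq_bigr => -[a b] _; rewrite inE /=.
case: injectiveP => hab.
  have hinj : injective (fun i => - (a i + b i) : 'I_n).
    by move=> i j /oppr_inj; exact: hab.
  rewrite (bigD1 (perm hinj)) //= big1 ?addn0.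
    have -> : [forall i, a i + b i + perm hinj i == 0 :> 'I_n] by
      apply/forallP => i; rewrite permE subrr.
    by [].
  move=> c hc; case: forallP => // h; case/eqP: hc; apply/permP => i; rewrite permE.
  by apply/eqP; rewrite -addr_eq0 addrC; exact: h.
rewrite big1 // => c _; case: forallP => // h; case: hab => i j hij.
apply: (@perm_inj _ c); have := h i; have := h j.
rewrite !(addrC (_ + _)) !addr_eq0 => /eqP -> /eqP ->.
by rewrite hij.
Qed.

Lemma sum_fhat3 :
  (n`!)%:R ^+ 3 * \sum_chi fhat chi ^+ 3 = n%:R ^+ n * (s n)%:R.
Proof.
apply: (@complexI R).
rewrite !rmorphM !rmorphXn /= !rmorph_nat rmorph_sum big_distrr /=.
transitivity (\sum_chi charsum chi ^+ 3).
  apply: eq_bigr => chi _; rewrite charsumE !rmorphM /= rmorph_nat; ring.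
rewrite -sum_zero_triples natr_sum big_distrr /=.
under eq_bigr => chi _.
  rewrite exprS expr2 {1}/charsum big_distrl /=.
  under eq_bigr => a _.
    rewrite {1}/charsum big_distrl big_distrr /=.
    under eq_bigr => b _.
      rewrite /charsum big_distrr big_distrr /=.
      under eq_bigr => c _ do rewrite -!big_split /=.
      over.
    over.
  over.
rewrite exchange_big /=; apply: eq_bigr => a _.
rewrite natr_sum big_distrr exchange_big /=; apply: eq_bigr => b _.
rewrite natr_sum big_distrr exchange_big /=; apply: eq_bigr => c _.
rewrite -sum_freq_prod; apply: eq_bigr => chi _; apply: eq_bigr => i _.
by rewrite !echarDr mulrA.
Qed.

End Coefficients.

(** * Shift invariance, the merging recursion, and Parseval with noise *)

Section Identities.
Variables (R : realType) (k : nat).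
Local Notation n := k.+1.
Local Notation C := (R[i]).
Local Notation freq := {ffun 'I_n -> 'I_n}.

Definition mult (chi : freq) (c : 'I_n) : nat := #|[pred i | chi i == c]|.
Definition weight (chi : freq) : nat := #|[pred i | chi i != 0%R]|.
Definition merge (chi : freq) (i j : 'I_n) : freq :=
  [ffun l => if l == i then 0 else if l == j then chi i + chi j else chi l].

Lemma mult0_weight chi : (mult chi 0%R + weight chi = n)%N.
Proof.
have := cardC [pred i | chi i == 0%R].
by rewrite card_ord => <-; congr (_ + _)%N; apply: eq_card => i; rewrite !inE.
Qed.

Lemma fhat_charsum (chi psi : freq) :
  charsum R chi = charsum R psi -> fhat R chi = fhat R psi.
Proof. by rewrite /fhat => ->. Qed.

(** The shift multiplies each term by [omega] to the power c (0 + 1 + ... + k), and this sum is n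
    k/2, a multiple of n because k is even. This is where the oddness of n enters. *)
Lemma fhat_shift (c : 'I_n) (chi : freq) : ~~ odd k ->
  fhat R [ffun i => chi i + c] = fhat R chi.
Proof.
move=> even_k; apply: fhat_charsum; apply: eq_bigr => sigma _.
under eq_bigr => i _ do rewrite ffunE echarDl.
rewrite big_split /= -[RHS]mulr1; congr (_ * _).
have -> : \prod_i echar C c (sigma i) = \prod_g echar C c g.
  by rewrite [RHS](reindex_inj (@perm_inj _ sigma)).
rewrite /echar prodrXr -big_distrr /=.
have -> : (\sum_(i < n) i = k./2 * n)%N.
  rewrite -(big_mkord xpredT id) bin2_sum bin2 /= -{2}(odd_double_half k).
  by rewrite (negbTE even_k) add0n -doubleMr doubleK mulnC.
by rewrite mulnA mulnC exprM (prim_expr_order (omegaP _ _)) expr1n.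
Qed.

Lemma charsum_perm (p : {perm 'I_n}) (chi : freq) :
  charsum R [ffun i => chi (p i)] = charsum R chi.
Proof.
rewrite /charsum (reindex_inj (mulgI p)) /=; apply: eq_bigr => sigma _.
rewrite [RHS](reindex_inj (@perm_inj _ p)) /=.
by apply: eq_bigr => i _; rewrite ffunE permM.
Qed.

(* Summing the character [chi i] over all values gives [0]; moving it onto the
   value taken at [j] instead of [i] merges the two frequencies. *)
Lemma fhat_rec (chi : freq) (i : 'I_n) : chi i != 0 ->
  (mult chi 0).+1%:R * fhat R chi =
  - \sum_(j | (j != i) && (chi j != 0)) fhat R (merge chi i j).
Proof.
move=> chi_i.
pose P (sigma : {perm 'I_n}) := \prod_(l | l != i) echar C (chi l) (sigma l).
have Smerge j : j != i ->
    \sum_(sigma : {perm 'I_n}) P sigma * echar C (chi i) (sigma j) =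
    charsum R (merge chi i j).
  move=> ji; apply: eq_bigr => sigma _.
  rewrite [RHS](bigD1 i) //= ffunE eqxx echar0 mul1r.
  rewrite [RHS](bigD1 j) //= /P (bigD1 j) //= ffunE eqxx (negbTE ji) echarDl.
  rewrite [X in _ = _ * X](eq_bigr (fun l => echar C (chi l) (sigma l))).
    by ring.
  by move=> l /andP[li lj]; rewrite ffunE (negbTE li) (negbTE lj).
have S0 : \sum_(j : 'I_n) \sum_(sigma : {perm 'I_n})
    P sigma * echar C (chi i) (sigma j) = 0.
  rewrite exchange_big /= big1 // => sigma _; rewrite -big_distrr /=.
  have -> : \sum_j echar C (chi i) (sigma j) = \sum_g echar C (chi i) g.
    by rewrite [RHS](reindex_inj (@perm_inj _ sigma)).
  by rewrite sum_echar (negbTE chi_i) !mulr0.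
have Si : \sum_(sigma : {perm 'I_n}) P sigma * echar C (chi i) (sigma i) =
    charsum R chi.
  by apply: eq_bigr => sigma _; rewrite [RHS](bigD1 i) //= mulrC.
(* Merging into a zero entry merely swaps the entries at [i] and [j]. These [j], together with
   [j = i], account for the coefficient [(mult chi 0).+1]. *)
have Sz j : (chi j == 0) -> charsum R (merge chi i j) = charsum R chi.
  move=> /eqP chi_j; rewrite -(charsum_perm (tperm i j) chi); congr charsum.
  apply/ffunP => l; rewrite !ffunE; case: tpermP => [->|->|/eqP/negbTE -> /eqP/negbTE -> //].
    by rewrite eqxx chi_j.
  rewrite eqxx chi_j addr0; case: (eqVneq j i) => // ji.
  by rewrite -ji chi_j.
have key : (mult chi 0).+1%:R * charsum R chi =
    - \sum_(j | (j != i) && (chi j != 0)) charsum R (merge chi i j).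
  apply/eqP; rewrite -subr_eq0 opprK -{2}S0 [in X in _ == X](bigD1 i) //= Si.
  rewrite [X in _ == _ + X](bigID (fun j => chi j == 0)) /=.
  rewrite addrA -natr1 mulrDl mul1r [_%:R * _ + _]addrC; apply/eqP.
  congr (_ + _ + _); last by apply: eq_bigr => j /andP[ji _]; rewrite Smerge.
  rewrite (eq_bigr (fun=> charsum R chi)) => [|j /andP[ji cj]]; last first.
    by rewrite Smerge // Sz.
  rewrite sumr_const mulr_natl; congr (_ *+ _).
  apply: eq_card => j; rewrite !inE unfold_in.
  by case: (eqVneq j i) => [->|_] //=; rewrite (negbTE chi_i).
apply: (mulfI (factR_neq0 R n)); apply: (@complexI R).
rewrite mulrCA mulrN big_distrr rmorphM /= -charsumE rmorph_nat key rmorphN rmorph_sum.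
by congr (- _); apply: eq_bigr => j _; rewrite charsumE.
Qed.

Lemma card_perm_fix (J : {set 'I_n}) :
  (\sum_(a : {perm 'I_n}) [forall i in J, a i == i] = (n - #|J|)`!)%N.
Proof.
have <- : #|~: J| = (n - #|J|)%N by rewrite cardsCs finset.setCK card_ord.
rewrite -card_perm -sum1_card [RHS]big_mkcond; apply: eq_bigr => a _.
suff -> : (a \in perm_on (~: J)) = [forall i in J, a i == i] by case: ifP.
apply/fintype.subsetP/forall_inP => h i.
  by move=> iJ; apply: contraTT (iJ) => /(h i); rewrite inE.
by rewrite !inE; apply: contra => /h.
Qed.

Lemma sum_set_card (F : nat -> R) :
  \sum_(J : {set 'I_n}) F #|J| = \sum_(j < n.+1) 'C(n, j)%:R * F j.
Proof.
have hJ (J : {set 'I_n}) : (#|J| < n.+1)%N.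
  by rewrite ltnS -[X in (_ <= X)%N](card_ord n) max_card.
rewrite (partition_big (fun J : {set 'I_n} => Ordinal (hJ J)) xpredT) //=.
apply: eq_bigr => j _.
rewrite (eq_bigr (fun=> F j)) => [|J /eqP <- //].
have -> : 'C(n, j) = #|[set A : {set 'I_n} | #|A| == j]| by rewrite card_draws card_ord.
rewrite sumr_const mulr_natl; congr (_ *+ _).
by rewrite cardsE; apply: eq_card => J; rewrite !unfold_in.
Qed.

Lemma sum_perm_fix (x y : R) :
  \sum_(a : {perm 'I_n}) \prod_i (x * (a i == i)%:R + y) =
  (n`!)%:R * \sum_(j < n.+1) y ^+ (n - j) * x ^+ j / (j`!)%:R.
Proof.
under eq_bigr => a _ do rewrite bigA_distr.
rewrite exchange_big /=.
transitivity (\sum_(J : {set 'I_n}) ((n - #|J|)`!)%:R * (y ^+ (n - #|J|) * x ^+ #|J|)).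
  apply: eq_bigr => J _.
  rewrite -card_perm_fix natr_sum big_distrl /=; apply: eq_bigr => a _.
  rewrite (bigID (mem J)) /=.
  rewrite (eq_bigr (fun i => x * (a i == i)%:R)) => [|i ->//].
  rewrite [X in _ * X](eq_bigr (fun=> y)) => [|i /negbTE ->//].
  rewrite big_split /= !prodr_const.
  have -> : #|[pred i | i \notin J]| = (n - #|J|)%N.
    have hJ : (#|J| + #|[pred i | i \notin J]| = n)%N.
      by rewrite -[RHS]card_ord -(cardC (mem J)); congr (_ + _)%N; apply: eq_card.
    by rewrite -[X in (X - _)%N]hJ addKn.
  have -> : \prod_(i in J) (a i == i)%:R = [forall i in J, a i == i]%:R :> R.
    case: forall_inP => h; first by rewrite big1 // => i /h ->.
    have : ~~ [forall i in J, a i == i] by apply/forall_inP.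
    rewrite negb_forall_in => /exists_inP[i iJ /negbTE hi].
    by apply/eqP/prodf_eq0; exists i => //; rewrite hi.
  by ring.
rewrite (sum_set_card (fun j => ((n - j)`!)%:R * (y ^+ (n - j) * x ^+ j))).
rewrite big_distrr; apply: eq_bigr => j _ /=.
have hb : 'C(n, j)%:R * ((j`!)%:R * ((n - j)`!)%:R) = (n`!)%:R :> R.
  by rewrite -!natrM bin_fact // -ltnS.
have aux (c a b N x' y' : R) : c * (a * b) = N -> a != 0 ->
  c * (b * (y' * x')) = N * (y' * x' / a) by move=> <- ?; field.
by apply: aux hb _; exact: factR_neq0.
Qed.

(* Parseval's identity with the weight [z] on every non-zero frequency; the
   sum over pairs of bijections reduces to counting fixed points. *)
Lemma noise_identity (z : R) :
  \sum_(chi : freq) fhat R chi ^+ 2 * z ^+ weight chi =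
  \sum_(j < n.+1) (1 - z) ^+ (n - j) * (z * n%:R) ^+ j / (j`!)%:R.
Proof.
apply: (mulfI (factR_neq0 R n)); rewrite -sum_perm_fix.
apply: (mulfI (factR_neq0 R n)).
pose zc := real_complex R z.
pose wz (c : 'I_n) : C := if c == 0 then 1 else zc.
apply: (@complexI R).
transitivity (\sum_chi charsum R chi * (charsum R chi)^*%R * \prod_i wz (chi i)).
  rewrite !big_distrr rmorph_sum; apply: eq_bigr => chi _ /=.
  rewrite charsum_conj charsumE.
  have -> : \prod_i wz (chi i) = real_complex R (z ^+ weight chi).
    rewrite (bigID (fun i => chi i == 0)) /= big1 ?mul1r => [|i hi]; last by rewrite /wz hi.
    rewrite (eq_bigr (fun=> zc)) => [|i /negbTE hi]; last by rewrite /wz hi.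
    by rewrite prodr_const /zc -rmorphXn.
  by rewrite -!rmorphM; congr (real_complex R _); ring.
have wzE c : wz c = zc + (1 - zc) * (c == 0)%:R.
  by rewrite /wz; case: eqP => _ /=; ring.
have expand (chi : freq) : charsum R chi * (charsum R chi)^*%R * \prod_i wz (chi i) =
    \sum_(a : {perm 'I_n}) \sum_(b : {perm 'I_n})
      \prod_i (wz (chi i) * echar C (chi i) (a i - b i)).
  rewrite {1}/charsum !big_distrl /=; apply: eq_bigr => a _.
  rewrite rmorph_sum big_distrr big_distrl /=; apply: eq_bigr => b _.
  rewrite rmorph_prod -!big_split /=; apply: eq_bigr => i _.
  by rewrite [(_)^*%R]conj_echar -echarNr echarDr mulrC mulrA.
rewrite (eq_bigr _ (fun chi _ => expand chi)) exchange_big /=.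
under eq_bigr => a _ do rewrite exchange_big.
rewrite exchange_big /=.
have sumw (d : 'I_n) : \sum_c wz c * echar C c d = zc * n%:R * (d == 0)%:R + (1 - zc).
  rewrite (eq_bigr (fun c => zc * echar C d c + (1 - zc) * ((c == 0)%:R * echar C c d))).
    rewrite big_split /= -!big_distrr /= sum_echar (bigD1 0) //= big1 => [|c /negbTE ->]; last by rewrite mul0r.
    by rewrite echar0; ring.
  by move=> c _; rewrite wzE (echarC _ d); ring.
have inner (b : {perm 'I_n}) :
    \sum_(a : {perm 'I_n}) \sum_(chi : freq) \prod_i (wz (chi i) * echar C (chi i) (a i - b i)) =
    real_complex R (\sum_(a : {perm 'I_n}) \prod_i (z * n%:R * (a i == i)%:R + (1 - z))).
  (* With [a * b] in place of [a], the coincidences of [a] and [b] become the fixed points of [a],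
     so the sum no longer depends on [b]. *)
  rewrite (reindex_inj (mulIg b)) rmorph_sum /=; apply: eq_bigr => a _.
  rewrite -(bigA_distr_bigA (fun i c => wz c * echar C c ((a * b)%g i - b i))) rmorph_prod.
  apply: eq_bigr => i _; rewrite sumw permM subr_eq0 (inj_eq perm_inj).
  by rewrite rmorphD !rmorphM rmorphB !rmorph_nat rmorph1.
rewrite (eq_bigr _ (fun b _ => inner b)) sumr_const.
rewrite rmorphM rmorph_nat mulr_natl; congr (_ *+ _).
exact: card_Sn.
Qed.

End Identities.

(** * Types of frequencies and the pointwise bound *)

Section Types.
Variables (R : realType) (k : nat).
Local Notation n := k.+1.
Local Notation C := (R[i]).
Local Notation freq := {ffun 'I_n -> 'I_n}.

Definition same_type (chi h : freq) : bool := [forall c, mult h c == mult chi c].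

Lemma sum_mult (chi : freq) : (\sum_c mult chi c = n)%N.
Proof.
rewrite -[RHS](card_ord n) -sum1_card [RHS](partition_big (fun i => chi i) xpredT) //=.
by apply: eq_bigr => c _; rewrite /mult -sum1_card; apply: eq_bigl => i; rewrite !inE.
Qed.

Lemma prod_mult (T : comPzSemiRingType) (F : 'I_n -> T) (chi : freq) :
  \prod_i F (chi i) = \prod_c F c ^+ mult chi c.
Proof.
rewrite (partition_big (fun i => chi i) xpredT) //=; apply: eq_bigr => c _.
rewrite (eq_bigr (fun=> F c)) => [|i /eqP -> //].
by rewrite prodr_const.
Qed.

Lemma mult_le (chi : freq) c : (mult chi c <= n)%N.
Proof. by rewrite -[X in (_ <= X)%N](sum_mult chi) (bigD1 c) //= leq_addr. Qed.

Lemma mult_perm (chi : freq) (p : {perm 'I_n}) c :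
  mult [ffun i => chi (p i)] c = mult chi c.
Proof.
rewrite /mult -!sum1_card [RHS](reindex_inj (@perm_inj _ p)) /=.
by apply: eq_bigl => i; rewrite !inE ffunE.
Qed.

Lemma same_typeP (chi h : freq) :
  reflect (exists p : {perm 'I_n}, h = [ffun i => chi (p i)]) (same_type chi h).
Proof.
apply: (iffP forallP) => [hm|[p -> c]]; last by rewrite mult_perm.
have cnt (z : freq) c : count_mem c [tuple z i | i < n] = mult z c.
  rewrite count_map -sum1_count big_enum_cond /= /mult -sum1_card.
  by apply: eq_bigl => i; rewrite !inE.
have /tuple_permP[p hp] : perm_eq [tuple h i | i < n] [tuple chi i | i < n].
  by apply/allP => c _ /=; rewrite !cnt; exact: hm.
exists p; apply/ffunP => i; rewrite ffunE.
have := congr1 (fun s => nth 0 s i) hp.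
rewrite -!tnth_nth !tnth_mktuple.
by move=> ->.
Qed.

Lemma same_type_fhat (chi h : freq) : same_type chi h -> fhat R h = fhat R chi.
Proof. by move=> /same_typeP[p ->]; apply: fhat_charsum; exact: charsum_perm. Qed.

(** A permutation preserving [chi] maps each fibre of [chi] to itself and is determined by its
    restrictions to the fibres. *)
Lemma card_stab (chi : freq) :
  (#|[set p : {perm 'I_n} | [forall j, chi (p j) == chi j]]| <= \prod_c (mult chi c)`!)%N.
Proof.
pose fib c := [set i | chi i == c].
pose F (p : {perm 'I_n}) := [ffun c => restr_perm (fib c) p].
set S := [set p | _].
have inN p c : p \in S -> p \in ('N(fib c | 'P))%g.
  rewrite inE => /forallP hp; apply/astabsP => i /=.
  by rewrite apermE !inE (eqP (hp i)).
have Finj : {in S &, injective F}.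
  move=> p q pS qS /ffunP hF; apply/permP => i.
  have := hF (chi i); rewrite !ffunE => /permP/(_ i).
  by rewrite !restr_permE ?inN // inE eqxx.
rewrite -(card_in_imset Finj).
have -> : (\prod_c (mult chi c)`! = #|family (fun c => [pred p | perm_on (fib c) p])|)%N.
  rewrite -sum1_card (eq_bigr (fun f : {ffun _ -> _} => \prod_(c < n) 1)%N); last by move=> f _; rewrite big1.
  rewrite -(bigA_distr_big_dep (fun c p => perm_on (fib c) p) (fun _ _ => 1%N)) /=.
  apply: eq_bigr => c _; rewrite sum1_card.
  have -> : mult chi c = #|fib c| by apply: eq_card => i; rewrite !inE.
  by rewrite -card_perm.
apply/subset_leq_card/fintype.subsetP => f /imsetP[p _ ->].
by apply/familyP => c; rewrite ffunE inE; exact: restr_perm_on.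
Qed.

(** Orbit counting: the permutations carrying [chi] to a given [h] form a coset of the stabiliser.
    The resulting lower bound on the class size turns [fhat_type_le] into the pointwise bound
    [fhat_le]. *)
Lemma card_type (chi : freq) :
  (n`! <= #|[pred h | same_type chi h]| * \prod_c (mult chi c)`!)%N.
Proof.
rewrite -card_Sn -sum1_card (partition_big (fun p : {perm 'I_n} => [ffun i => chi (p i)]) (same_type chi)) /=; last first.
  by move=> p _; apply/same_typeP; exists p.
rewrite -sum1_card big_distrl /=; apply: leq_sum => h /same_typeP[q ->]; rewrite mul1n.
apply: leq_trans (card_stab chi).
have inj : injective (fun p : {perm 'I_n} => q^-1 * p)%g by exact: mulgI.
rewrite sum1_card -(card_imset _ inj); apply/subset_leq_card/fintype.subsetP => p.
move=> /imsetP[p' hp' ->]; rewrite inE; apply/forallP => j; rewrite permM.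
move: hp'; rewrite unfold_in => hp'.
have {}hp' : [ffun i => chi (p' i)] = [ffun i => chi (q i)] :> freq by exact/eqP.
have := congr1 (fun f : freq => f ((q^-1)%g j)) hp'.
by rewrite !ffunE permKV => ->.
Qed.

Definition char_prod (h : freq) : C := \prod_g echar C (h g) g.

(** Double counting over pairs of a class member and a permutation: [charsum] is constant on the
    class, and composing with a permutation maps the class onto itself. The sum on the right is the
    coefficient of prod_c x_c^(mult chi c) in prod_g sum_c x_c e(cg/n). *)
Lemma card_type_charsum (chi : freq) :
  #|[pred h | same_type chi h]|%:R * charsum R chi =
  (n`!)%:R * \sum_(h | same_type chi h) char_prod h.
Proof.
rewrite mulr_natl -sumr_const.
transitivity (\sum_(h | same_type chi h) charsum R h).
  by apply: eq_bigr => h /same_typeP[p ->]; rewrite charsum_perm.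
rewrite exchange_big /= mulr_natl -card_Sn -sumr_const; apply: eq_bigr => a _.
have Tinj : injective (fun h : freq => [ffun i => h (a i)]).
  move=> h1 h2 /ffunP e; apply/ffunP => i; have := e (a^-1 i)%g.
  by rewrite !ffunE permKV.
rewrite (reindex_inj Tinj) /=; apply: eq_big => [h|h _].
  by apply/eq_forallb => c; rewrite mult_perm.
rewrite /char_prod [RHS](reindex_inj (@perm_inj _ a)) /=.
by apply: eq_bigr => i _; rewrite ffunE.
Qed.

Lemma parseval (x : 'I_n -> C) :
  \sum_g `|\sum_c x c * echar C c g| ^+ 2 = n%:R * \sum_c `|x c| ^+ 2.
Proof.
under eq_bigr => g _.
  rewrite normCK rmorph_sum big_distrl /=.
  under eq_bigr => c _.
    rewrite big_distrr /=.
    under eq_bigr => d _ do rewrite rmorphM /= [(echar _ _ _)^*%R]conj_echar mulrACA -echarDl.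
    over.
  over.
rewrite exchange_big big_distrr /=; apply: eq_bigr => c _.
rewrite exchange_big /= (bigD1 c) //= [X in _ + X]big1 => [|d dc /=].
  by rewrite -big_distrr /= sum_echar subrr eqxx mulr1 addr0 normCK mulrC.
by rewrite -mulr_sumr sum_echar subr_eq0 (negbTE (_ : c != d)) ?mulr0 // eq_sym.
Qed.

Lemma prod_norm_le1 (x : 'I_n -> C) : \sum_c `|x c| ^+ 2 = 1 ->
  `|\prod_g \sum_c x c * echar C c g| <= 1.
Proof.
move=> hx; rewrite -(@expr_le1 _ 2) // -normrX -prodrXl normr_prod.
have := @leif_AGM _ _ (@predT 'I_n) (fun g => `|\sum_c x c * echar C c g| ^+ 2)
  (fun g _ => exprn_ge0 2 (normr_ge0 _)).
move=> [+ _]; rewrite card_ord parseval hx mulr1 divff ?pnatr_eq0 // expr1n.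
by under [X in X <= _ -> _]eq_bigr => g _ do rewrite -normrX.
Qed.

End Types.

(** * Coefficient extraction; bounds for one frequency and for the cubes over a type *)

Section TypeBounds.
Variables (R : realType) (k : nat).
Local Notation n := k.+1.
Local Notation C := (R[i]).
Local Notation freq := {ffun 'I_n -> 'I_n}.

(* The coefficient of [prod_c x_c ^ mult chi c] in [prod_g sum_c x_c e(c, g)],
   extracted by averaging the phases of the [x_c] over roots of unity of order
   [n + 1], which separate all exponents in [0, n]. *)
Lemma type_sum_average (rho : 'I_n -> C) (chi : freq) :
  n.+1%:R ^+ n * (\prod_c rho c ^+ mult chi c *
     \sum_(h | same_type chi h) char_prod R h) =
  \sum_(t : {ffun 'I_n -> 'I_n.+1})
     (\prod_c echar C (inord (mult chi c)) (- t c)) *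
     \prod_g \sum_c (rho c * echar C (inord 1) (t c)) * echar C c g.
Proof.
have pw (m : nat) (j : 'I_n.+1) : (m <= n)%N -> echar C (inord 1) j ^+ m = echar C (inord m) j.
  by move=> hm; rewrite /echar !inordK ?mul1n -?exprM 1?mulnC.
have expand (t : {ffun 'I_n -> 'I_n.+1}) :
    \prod_g \sum_c (rho c * echar C (inord 1) (t c)) * echar C c g =
    \sum_(h : freq) char_prod R h * \prod_c rho c ^+ mult h c *
        \prod_c echar C (inord (mult h c)) (t c).
  rewrite bigA_distr_bigA; apply: eq_bigr => h _.
  rewrite big_split /= mulrC -mulrA; congr (_ * _).
  rewrite (prod_mult (fun c => rho c * echar C (inord 1) (t c))) -big_split /=.
  by apply: eq_bigr => c _; rewrite exprMn pw // mult_le.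
under [RHS]eq_bigr => t _ do rewrite expand big_distrr /=.
rewrite [RHS]exchange_big /= [RHS](bigID (same_type chi)) /= [X in _ = _ + X]big1 ?addr0.
  rewrite big_distrr big_distrr /=; apply: eq_bigr => h hchi.
  rewrite [RHS](eq_bigr (fun=> char_prod R h * \prod_c rho c ^+ mult chi c)).
    by rewrite sumr_const card_ffun !card_ord -[RHS]mulr_natl natrX [char_prod _ _ * _]mulrC.
  move=> t _; rewrite mulrCA -[X in _ * X = _]big_split /= [X in _ * X = _]big1 ?mulr1.
    by congr (_ * _); apply: eq_bigr => c _; rewrite (eqP (forallP hchi c)).
  by move=> c _; rewrite (eqP (forallP hchi c)) -echarDr addNr echarC echar0.
move=> h /forallPn[c hc].
under eq_bigr => t _ do rewrite mulrCA -[X in _ * X]big_split /=.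
rewrite -big_distrr /=.
rewrite -(bigA_distr_bigA (fun c j => echar C (inord (mult chi c)) (- j) * echar C (inord (mult h c)) j)).
apply/eqP; rewrite mulf_eq0; apply/orP; right; apply/prodf_eq0; exists c => //.
under eq_bigr => j _ do rewrite echarNr -echarDl.
rewrite sum_echar addrC subr_eq0.
have -> : (inord (mult h c) == inord (mult chi c) :> 'I_n.+1) = false.
  by rewrite -val_eqE /= !inordK ?ltnS ?mult_le // (negbTE hc).
by rewrite mulr0.
Qed.

Lemma type_sum_le (rho : 'I_n -> C) (chi : freq) : \sum_c `|rho c| ^+ 2 = 1 ->
  `|\prod_c rho c ^+ mult chi c * \sum_(h | same_type chi h) char_prod R h| <= 1.
Proof.
move=> hrho.
have pos : 0 < n.+1%:R ^+ n :> C by rewrite exprn_gt0 // ltr0n.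
rewrite -(ler_pM2l pos) mulr1 -[X in X * _](ger0_norm (ltW pos)) -normrM.
rewrite type_sum_average; apply: le_trans (ler_norm_sum _ _ _) _.
apply: (@le_trans _ _ (\sum_(t : {ffun 'I_n -> 'I_n.+1}) 1)); last first.
  by rewrite sumr_const card_ffun !card_ord -natrX.
apply: ler_sum => t _; rewrite normrM.
have -> : `|\prod_c echar C (inord (mult chi c)) (- t c)| = 1.
  by rewrite normr_prod big1 // => c _; rewrite norm_echar.
rewrite mul1r; apply: prod_norm_le1.
by rewrite -hrho; apply: eq_bigr => c _; rewrite normrM norm_echar mulr1.
Qed.

(* [sqrtpow r r] is [r ^ (r/2)], equal to [1] for [r = 0]. *)
Definition sqrtpow (m j : nat) : R := Num.sqrt m%:R ^+ j.

Lemma sqrtpow_gt0 m : 0 < sqrtpow m m.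
Proof.
case: m => [|m]; rewrite /sqrtpow; first by rewrite expr0.
by rewrite exprn_gt0 // sqrtr_gt0 ltr0n.
Qed.

Lemma type_sum_le_real (chi : freq) :
  `|\sum_(h | same_type chi h) char_prod R h| <=
  real_complex R (sqrtpow n n / \prod_c sqrtpow (mult chi c) (mult chi c)).
Proof.
pose rho c := real_complex R (Num.sqrt (mult chi c)%:R / Num.sqrt n%:R).
have sn : 0 < Num.sqrt n%:R :> R by rewrite sqrtr_gt0 ltr0n.
have rho_ge0 c : 0 <= rho c by rewrite ler0c divr_ge0 ?sqrtr_ge0.
have h1 : \sum_c `|rho c| ^+ 2 = 1.
  transitivity (real_complex R (\sum_c (mult chi c)%:R / n%:R)).
    rewrite rmorph_sum; apply: eq_bigr => c _; rewrite ger0_norm // -rmorphXn.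
    by congr (real_complex R _); rewrite expr_div_n !sqr_sqrtr ?ler0n.
  by rewrite -mulr_suml -natr_sum sum_mult divff ?pnatr_eq0 ?rmorph1.
have := type_sum_le chi h1; rewrite normrM.
have -> : \prod_c rho c ^+ mult chi c =
    real_complex R ((\prod_c sqrtpow (mult chi c) (mult chi c)) / sqrtpow n n).
  transitivity (real_complex R (\prod_c (sqrtpow (mult chi c) (mult chi c) / Num.sqrt n%:R ^+ mult chi c))).
    rewrite rmorph_prod; apply: eq_bigr => c _.
    by rewrite -rmorphXn expr_div_n.
  congr (real_complex R _).
  by rewrite prodf_div; congr (_ / _); rewrite prodrXr sum_mult.
set P := \prod_c _; have P_gt0 : 0 < P by apply: prodr_gt0 => c _; exact: sqrtpow_gt0.
have Q_gt0 : 0 < P / sqrtpow n n by rewrite divr_gt0 ?sqrtpow_gt0.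
have hQ : 0 <= real_complex R (P / sqrtpow n n) by rewrite ler0c ltW.
rewrite (ger0_norm hQ) => h.
have inv : sqrtpow n n / P = (P / sqrtpow n n)^-1 by rewrite invf_div.
by rewrite inv fmorphV -div1r ler_pdivlMr ?ltcR // mulrC.
Qed.

(** The contribution of one value of multiplicity r to the bound on |f| ([afac]) and to the bound on
    the sum of |f|^3 over a type ([bfac]). By Stirling they are about sqrt(2 pi r) (sqrt r / e)^r
    and 2 pi r (sqrt r / e^2)^r. *)
Definition afac (r : nat) : R := (r`!)%:R / sqrtpow r r.
Definition bfac (r : nat) : R := (r`!)%:R ^+ 2 / sqrtpow r r ^+ 3.

Lemma afac_ge0 r : 0 <= afac r.
Proof. by rewrite divr_ge0 ?ler0n // ltW // sqrtpow_gt0. Qed.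

Lemma bfac_ge0 r : 0 <= bfac r.
Proof. by rewrite divr_ge0 ?exprn_ge0 ?ler0n // ltW // sqrtpow_gt0. Qed.

Lemma fhat_type_le (chi : freq) :
  #|[pred h | same_type chi h]|%:R * `|fhat R chi| <=
    sqrtpow n n / \prod_c sqrtpow (mult chi c) (mult chi c).
Proof.
rewrite -lecR; apply: le_trans (type_sum_le_real chi).
have fgt : 0 < (n`!)%:R :> C by rewrite ltr0n fact_gt0.
rewrite -(ler_pM2l fgt) -[X in _ <= X * _](ger0_norm (ltW fgt)) -normrM -card_type_charsum.
have normR (x : R) : `|real_complex R x| = real_complex R `|x|.
  by rewrite normc_def /= expr0n addr0 sqrtr_sqr.
rewrite charsumE -!(rmorph_nat (real_complex R)) -!rmorphM normR lecR.
by rewrite !normrM !normr_nat mulrCA.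
Qed.

Lemma class_gt0 (chi : freq) : (0 < #|[pred h | same_type chi h]|)%N.
Proof. by apply/card_gt0P; exists chi; rewrite inE; apply/forallP. Qed.

Lemma fhat_le (chi : freq) :
  `|fhat R chi| <= sqrtpow n n / (n`!)%:R * \prod_c afac (mult chi c).
Proof.
set N := #|[pred h | same_type chi h]|.
have N_gt0 : 0 < N%:R :> R by rewrite ltr0n class_gt0.
have := fhat_type_le chi; rewrite -/N mulrC -ler_pdivlMr // => /le_trans; apply.
rewrite prodf_div.
have := card_type chi; rewrite -/N -(ler_nat R) natrM natr_prod.
set P := \prod_c (_`!)%:R; set S := \prod_c _ => hP.
have S_gt0 : 0 < S by apply: prodr_gt0 => c _; exact: sqrtpow_gt0.
have f_gt0 : 0 < (n`!)%:R :> R by rewrite ltr0n fact_gt0.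
have -> : sqrtpow n n / (n`!)%:R * (P / S) = sqrtpow n n / S * (P / (n`!)%:R) by ring.
rewrite ler_wpM2l ?divr_ge0 ?(ltW (sqrtpow_gt0 _)) ?(ltW S_gt0) //.
by rewrite ler_pdivlMr // mulrC ler_pdivrMr // mulrC.
Qed.

(** One of the three factors |f| absorbs the class size through [fhat_type_le]; the other two are
    bounded by [fhat_le]. *)
Lemma class_fhat3_le (chi : freq) :
  \sum_(h | same_type chi h) `|fhat R h| ^+ 3 <=
  sqrtpow n n ^+ 3 / (n`!)%:R ^+ 2 * \prod_c bfac (mult chi c).
Proof.
set N := #|[pred h | same_type chi h]|.
have N_gt0 : 0 < N%:R :> R by rewrite ltr0n class_gt0.
rewrite (eq_bigr (fun=> `|fhat R chi| ^+ 3)); last by move=> h hh; rewrite (same_type_fhat R hh).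
rewrite sumr_const -/N.
have hle := fhat_le chi; have htype := fhat_type_le chi; rewrite -/N in htype.
rewrite -[leLHS]mulr_natl.
set f := `|_| in hle htype *; set S := \prod_c _ in htype.
have S_gt0 : 0 < S by apply: prodr_gt0 => c _; exact: sqrtpow_gt0.
have f_ge0 : 0 <= f by exact: normr_ge0.
have -> : sqrtpow n n ^+ 3 / (n`!)%:R ^+ 2 * \prod_c bfac (mult chi c) =
   (sqrtpow n n / S) * (sqrtpow n n / (n`!)%:R * \prod_c afac (mult chi c)) ^+ 2.
  rewrite /bfac /afac !prodf_div !prodrXl -/S; field.
  by rewrite factR_neq0 /= gt_eqF.
rewrite exprS mulrA; apply: ler_pM; rewrite ?mulr_ge0 ?exprn_ge0 ?ler0n //.
by apply: lerXn2r => //; rewrite nnegrE //; apply: le_trans hle.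
Qed.

End TypeBounds.

(** * Elementary real estimates *)

Section RealEstimates.
Variable R : realType.
Implicit Types (x w : R) (m n p r : nat).

Lemma exp_partial_sum x n : 0 <= x -> \sum_(j < n) x ^+ j / (j`!)%:R <= expR x.
Proof.
move=> x_ge0; rewrite /expR.
have -> : \sum_(j < n) x ^+ j / (j`!)%:R = series (exp_coeff x) n.
  by rewrite /series /= big_mkord; apply: eq_bigr => j _.
apply: nondecreasing_cvgn_le; last exact: is_cvg_series_exp_coeff.
apply/nondecreasing_seqP => j; rewrite /series /= big_nat_recr //= lerDl.
exact: exp_coeff_ge0.
Qed.

Lemma pow_le_fact_exp x m : 0 <= x -> x ^+ m <= (m`!)%:R * expR x.
Proof.
move=> x_ge0; rewrite mulrC -ler_pdivrMr ?ltr0n ?fact_gt0 //.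
apply: le_trans (exp_partial_sum m.+1 x_ge0).
by rewrite big_ord_recr /= lerDr sumr_ge0 // => j _; rewrite divr_ge0 ?exprn_ge0.
Qed.

Lemma expR_nat_mul n x : expR (n%:R * x) = expR x ^+ n.
Proof. by rewrite expRM_natl. Qed.

(** This is log(1 + w) >= w - w^2/2 in exponential form: the auxiliary [g] is nondecreasing, its
    derivative being a square times an exponential. *)
Lemma expR_sub_sqr_le w : 0 <= w -> expR (w - w ^+ 2 / 2) <= 1 + w.
Proof.
move=> w_ge0.
pose g (t : R) := (1 + t) * expR (t ^+ 2 / 2 - t).
have dg (t : R) : is_derive t (1 : R) g (t ^+ 2 * expR (t ^+ 2 / 2 - t)).
  rewrite /g; apply: is_derive_eq.
  by rewrite /GRing.scale /=; field.
have le_g : g 0 <= g w.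
  have [->//|w_neq0] := eqVneq w 0.
  have w_gt0 : 0 < w by rewrite lt_neqAle eq_sym w_neq0.
  apply: (@ger0_derive1_le_cc R g 0 w) => //.
  - move=> t _; rewrite derive1E; have [_ ->] := dg t.
    by rewrite mulr_ge0 ?expR_ge0 ?sqr_ge0.
  - apply: continuous_subspaceT => t; apply: differentiable_continuous.
    by apply/derivable1_diffP; case: (dg t).
  - by rewrite in_itv /= lexx.
  - by rewrite in_itv /= lexx w_ge0.
move: le_g; rewrite /g expr0n /= mul0r subrr expR0 addr0 mulr1.
have -> : w ^+ 2 / 2 - w = - (w - w ^+ 2 / 2) by ring.
by rewrite expRN ler_pdivlMr ?expR_gt0 // mul1r.
Qed.

Lemma fact_lower n : n%:R ^+ n <= (n`!)%:R * expR n%:R :> R.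
Proof. exact: pow_le_fact_exp. Qed.

(** Stirling's upper bound up to a factor of order sqrt r. With R = r + 1, the induction step
    amounts to (1 + 1/R)^(R+1) >= e. *)
Lemma fact_upper r : (r.+1`!)%:R * expR r.+1%:R <= expR 1 * r.+1%:R * r.+1%:R ^+ r.+1 :> R.
Proof.
elim: r => [|r IH]; first by rewrite expr1 !mulr1 mul1r.
have step : expR 1 * r.+1%:R ^+ r.+2 <= r.+2%:R ^+ r.+2 :> R.
  have h : r.+1%:R / r.+2%:R <= expR (- (r.+2%:R)^-1) :> R.
    apply: le_trans (expR_ge1Dx _).
    by rewrite ler_pdivrMr ?ltr0n // mulrDl mul1r mulNr mulVf ?pnatr_eq0 // -[r.+2%:R]natr1 addrK.
  have : (r.+1%:R / r.+2%:R) ^+ r.+2 <= expR (- (r.+2%:R)^-1) ^+ r.+2 :> R.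
    by apply: lerXn2r h; rewrite nnegrE ?divr_ge0 ?expR_ge0.
  rewrite -expRM_natl mulrN divff ?pnatr_eq0 // expRN expr_div_n.
  by rewrite ler_pdivrMr ?exprn_gt0 // mulrC ler_pdivlMr ?expR_gt0 // mulrC.
rewrite factS natrM -[in expR _](natr1 r.+1) expRD.
have -> : r.+2%:R * (r.+1`!)%:R * (expR r.+1%:R * expR 1) =
   r.+2%:R * expR 1 * ((r.+1`!)%:R * expR r.+1%:R) :> R by ring.
apply: (@le_trans _ _ (r.+2%:R * expR 1 * (expR 1 * r.+1%:R * r.+1%:R ^+ r.+1))).
  by rewrite ler_wpM2l // mulr_ge0 ?expR_ge0.
have -> : r.+2%:R * expR 1 * (expR 1 * r.+1%:R * r.+1%:R ^+ r.+1) =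
  r.+2%:R * expR 1 * (expR 1 * r.+1%:R ^+ r.+2) :> R by rewrite [in RHS]exprS; ring.
rewrite [X in _ <= X * _]mulrC.
by rewrite ler_wpM2l // mulr_ge0 ?expR_ge0.
Qed.

Lemma pow_fact_le p m : (p ^ m * p`! <= (p + m)`!)%N.
Proof.
elim: m => [|m IH]; first by rewrite expn0 mul1n addn0.
rewrite addnS factS expnS -mulnA leq_mul //.
by apply: leq_trans (leqnSn _); rewrite leq_addr.
Qed.

Lemma fact_le_pow r : (r`! <= r ^ r)%N.
Proof.
elim: r => // r IH; rewrite factS expnS leq_mul //.
by apply: leq_trans IH _; case: r => // r; rewrite leq_exp2r.
Qed.

End RealEstimates.

(** * Bounds at a fixed number of non-zero frequencies *)

Section LevelBounds.
Variables (R : realType) (k : nat).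
Local Notation n := k.+1.
Local Notation freq := {ffun 'I_n -> 'I_n}.
Local Notation sqn := (Num.sqrt n%:R : R).

Definition level2 (m : nat) : R := \sum_(chi : freq | weight chi == m) fhat R chi ^+ 2.

Lemma sqn_gt0 : 0 < sqn. Proof. by rewrite sqrtr_gt0 ltr0n. Qed.

Lemma sqn2 : sqn ^+ 2 = n%:R. Proof. by rewrite sqr_sqrtr ?ler0n. Qed.

Lemma level2_ge0 m : 0 <= level2 m.
Proof. by apply: sumr_ge0 => chi _; exact: sqr_ge0. Qed.

(** All other levels are dropped from [noise_identity] at z = w/(1 + w). Since 1 - z = 1/(1 + w),
    its right-hand side is then a truncated exponential series in n w, divided by (1 + w)^n. *)
Lemma level2_le_exp (w : R) m : 0 < w ->
  level2 m * w ^+ m <= (1 + w) ^+ m * (expR (n%:R * w) / (1 + w) ^+ n).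
Proof.
move=> w_gt0; have w1 : 0 < 1 + w by rewrite addr_gt0.
have w1n : 1 + w != 0 by rewrite gt_eqF.
pose z := w / (1 + w); have z_ge0 : 0 <= z by rewrite divr_ge0 ?ltW.
have : level2 m * z ^+ m <= expR (n%:R * w) / (1 + w) ^+ n.
  apply: (@le_trans _ _ (\sum_(chi : freq) fhat R chi ^+ 2 * z ^+ weight chi)).
    rewrite [leRHS](bigID (fun chi => weight chi == m)) /= mulr_suml.
    rewrite [X in _ <= X + _](eq_bigr (fun chi => fhat R chi ^+ 2 * z ^+ m)).
      by rewrite lerDl sumr_ge0 // => chi _; rewrite mulr_ge0 ?sqr_ge0 ?exprn_ge0.
    by move=> chi /eqP ->.
  rewrite noise_identity ler_pdivlMr ?exprn_gt0 //.
  apply: le_trans (exp_partial_sum n.+1 _); last by rewrite mulr_ge0 ?ler0n ?ltW.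
  rewrite le_eqVlt; apply/orP; left; apply/eqP; rewrite mulr_suml; apply: eq_bigr => j _.
  have -> : 1 - z = (1 + w)^-1 by rewrite /z; field.
  have jn : (j <= n)%N by rewrite -ltnS.
  have -> : (1 + w) ^+ n = (1 + w) ^+ (n - j) * (1 + w) ^+ j by rewrite -exprD subnK.
  rewrite /z exprVn !exprMn exprVn.
  have h1 : (1 + w) ^+ (n - j) != 0 by rewrite expf_neq0.
  have h2 : (1 + w) ^+ j != 0 by rewrite expf_neq0.
  have h3 := factR_neq0 R j.
  move: ((j`!)%:R : R) h3 ((1 + w) ^+ (n - j)) h1 ((1 + w) ^+ j) h2 => a ha b hb c hc.
  by field; rewrite ha hb hc.
move=> h; have -> : w ^+ m = (1 + w) ^+ m * z ^+ m by rewrite -exprMn /z mulrC divfK.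
by rewrite mulrCA ler_wpM2l // exprn_ge0 // ltW.
Qed.

Lemma expR_over_pow_le (w : R) : 0 <= w ->
  expR (n%:R * w) / (1 + w) ^+ n <= expR (n%:R * w ^+ 2 / 2).
Proof.
move=> w_ge0; have w1 : 0 < 1 + w by rewrite (lt_le_trans ltr01) // lerDl.
rewrite ler_pdivrMr ?exprn_gt0 //.
have -> : n%:R * w = n%:R * w ^+ 2 / 2 + n%:R * (w - w ^+ 2 / 2) by field.
rewrite expRD ler_wpM2l ?expR_ge0 // expR_nat_mul.
by apply: lerXn2r; rewrite ?nnegrE ?expR_ge0 ?(ltW w1) // expR_sub_sqr_le.
Qed.

Lemma level2_le m : (0 < m)%N ->
  level2 m * sqrtpow R m m <=
  sqn ^+ m * expR (m%:R / 2 + m%:R * (Num.sqrt m%:R / sqn)).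
Proof.
(* The choice w = sqrt(m/n) minimises e^(n w^2/2) / w^m. *)
move=> m_gt0; set w := Num.sqrt m%:R / sqn.
have w_gt0 : 0 < w by rewrite divr_gt0 ?sqn_gt0 // sqrtr_gt0 ltr0n.
have h := level2_le_exp m w_gt0.
have -> : sqrtpow R m m = sqn ^+ m * w ^+ m.
  by rewrite -exprMn /w mulrC divfK ?gt_eqF ?sqn_gt0.
rewrite mulrCA ler_wpM2l ?exprn_ge0 ?sqrtr_ge0 //; apply: le_trans h _.
rewrite [_ / 2 + _]addrC expRD; apply: ler_pM.
- by rewrite exprn_ge0 // addr_ge0 // ltW.
- by rewrite divr_ge0 ?expR_ge0 // exprn_ge0 // addr_ge0 // ltW.
- rewrite expR_nat_mul; apply: lerXn2r; rewrite ?nnegrE ?expR_ge0 ?addr_ge0 ?(ltW w_gt0) //.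
  exact: expR_ge1Dx.
apply: le_trans (expR_over_pow_le (ltW w_gt0)) _.
rewrite ler_expR le_eqVlt; apply/orP; left; apply/eqP; congr (_ / _).
by rewrite expr_div_n sqn2 sqr_sqrtr ?ler0n // mulrC divfK ?pnatr_eq0.
Qed.

(** For fixed m, w = n^(-1/2) already gives the order n^(m/2), and it also covers m = 0. *)
Lemma level2_crude m : level2 m <= expR (1 / 2) * (2 * sqn) ^+ m.
Proof.
have s0 := sqn_gt0; have sn0 : sqn != 0 by rewrite gt_eqF.
have s1 : 1 <= sqn by rewrite -[X in X <= _]sqrtr1 ler_sqrt ?ler0n // ler1n.
have w_gt0 : 0 < sqn^-1 by rewrite invr_gt0.
have := level2_le_exp m w_gt0.
rewrite exprVn ler_pdivrMr ?exprn_gt0 // => h; apply: le_trans h _.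
rewrite [(2 * _) ^+ _]exprMn [leRHS]mulrA; apply: ler_wpM2r.
  by rewrite exprn_ge0 // ltW.
rewrite [leRHS]mulrC; apply: ler_pM.
- by rewrite exprn_ge0 // addr_ge0 // ltW.
- by rewrite divr_ge0 ?expR_ge0 // exprn_ge0 // addr_ge0 // ltW.
- apply: lerXn2r; rewrite ?nnegrE ?addr_ge0 ?(ltW w_gt0) //.
  by rewrite lerD2l invf_le1.
apply: le_trans (expR_over_pow_le (ltW w_gt0)) _.
by rewrite exprVn sqn2 divff ?pnatr_eq0.
Qed.

(** The point is (n/p)^(p/2) = (1 + m/p)^(p/2) <= e^(m/2). *)
Lemma main_factor_le p m : (0 < p)%N -> (p + m = n)%N ->
  sqrtpow R n n / sqrtpow R p p <= expR (m%:R / 2) * sqn ^+ m.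
Proof.
move=> p_gt0 pm.
have sp : 0 < Num.sqrt p%:R :> R by rewrite sqrtr_gt0 ltr0n.
have -> : sqrtpow R n n = sqn ^+ m * sqn ^+ p by rewrite -exprD addnC pm.
rewrite ler_pdivrMr ?sqrtpow_gt0 // [X in _ <= X * _]mulrC -mulrA.
rewrite ler_wpM2l ?exprn_ge0 ?sqrtr_ge0 //.
have h : sqn <= expR (m%:R / (2 * p%:R)) * Num.sqrt p%:R.
  rewrite -(@ler_pXn2r _ 2) // ?nnegrE ?mulr_ge0 ?expR_ge0 ?sqrtr_ge0 //.
  rewrite exprMn sqn2 sqr_sqrtr ?ler0n // -expRM_natl.
  have -> : 2 * (m%:R / (2 * p%:R)) = m%:R / p%:R :> R by field; rewrite pnatr_eq0 -lt0n.
  rewrite -ler_pdivrMr ?ltr0n //; apply: le_trans (expR_ge1Dx _).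
  by rewrite -pm natrD mulrDl divff ?pnatr_eq0 -?lt0n.
have : sqn ^+ p <= (expR (m%:R / (2 * p%:R)) * Num.sqrt p%:R) ^+ p.
  by apply: lerXn2r h; rewrite nnegrE ?mulr_ge0 ?expR_ge0 ?sqrtr_ge0.
move=> /le_trans; apply; rewrite exprMn -expRM_natl.
by have -> : p%:R * (m%:R / (2 * p%:R)) = m%:R / 2 :> R by field; rewrite pnatr_eq0 -lt0n.
Qed.

Lemma fact_ratio_le p m : (0 < p)%N -> (p + m = n)%N ->
  (p`!)%:R / (n`!)%:R <= (p%:R ^+ m)^-1 :> R.
Proof.
move=> p_gt0 pm; rewrite ler_pdivrMr ?ltr0n ?fact_gt0 // ler_pdivlMl ?exprn_gt0 ?ltr0n //.
by rewrite -natrX -natrM ler_nat -pm pow_fact_le.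
Qed.

Lemma afac_main_le p m : (0 < p)%N -> (p + m = n)%N ->
  sqrtpow R n n / (n`!)%:R * afac R p <= expR (m%:R / 2) * (sqn / p%:R) ^+ m.
Proof.
move=> p_gt0 pm.
have -> : sqrtpow R n n / (n`!)%:R * afac R p =
    (sqrtpow R n n / sqrtpow R p p) * ((p`!)%:R / (n`!)%:R) by rewrite /afac; ring.
rewrite expr_div_n [leRHS]mulrA; apply: ler_pM.
- by rewrite divr_ge0 // ltW // sqrtpow_gt0.
- by rewrite divr_ge0.
- exact: main_factor_le.
- exact: fact_ratio_le.
Qed.

Lemma sqrtpow_sqr r : sqrtpow R r r ^+ 2 = r%:R ^+ r.
Proof. by rewrite /sqrtpow exprAC sqr_sqrtr ?ler0n. Qed.

Lemma fact_le_sqrtpow r : (r`!)%:R <= sqrtpow R r r ^+ 2.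
Proof. by rewrite sqrtpow_sqr -natrX ler_nat fact_le_pow. Qed.

Lemma afac_le r : afac R r <= sqrtpow R r r.
Proof. by rewrite ler_pdivrMr ?sqrtpow_gt0 // -expr2 fact_le_sqrtpow. Qed.

Lemma bfac_le r : bfac R r <= sqrtpow R r r.
Proof.
have S3 : 0 < sqrtpow R r r ^+ 3 by rewrite exprn_gt0 // sqrtpow_gt0.
rewrite ler_pdivrMr //.
have -> : sqrtpow R r r * sqrtpow R r r ^+ 3 = (sqrtpow R r r ^+ 2) ^+ 2 by ring.
by apply: lerXn2r (fact_le_sqrtpow r); rewrite nnegrE ?exprn_ge0 // ltW ?sqrtpow_gt0.
Qed.

Lemma sqrtpow_le r m : (r <= m)%N -> sqrtpow R r r <= sqrtpow R m r.
Proof.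
by move=> rm; apply: lerXn2r; rewrite ?nnegrE ?sqrtr_ge0 // ler_sqrt ?ler0n // ler_nat.
Qed.

Lemma sum_mult_pos (chi : freq) : (\sum_(c | c != 0%R) mult chi c)%N = weight chi.
Proof.
apply: (@addnI (mult chi 0%R)); rewrite mult0_weight -[RHS](sum_mult chi).
by rewrite [RHS](bigD1 0%R).
Qed.

Lemma fhat_weight_le (chi : freq) p m : (0 < p)%N -> (p + m = n)%N -> weight chi = m ->
  `|fhat R chi| <= expR (m%:R / 2) * (sqn / p%:R) ^+ m * \prod_(c | c != 0) afac R (mult chi c).
Proof.
move=> p_gt0 pm wm; apply: le_trans (fhat_le R chi) _.
rewrite (bigD1 0) //= mulrA.
have -> : mult chi 0 = p by apply/eqP; rewrite -(eqn_add2r m) -{1}wm mult0_weight pm.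
apply: ler_wpM2r; last exact: afac_main_le.
by apply: prodr_ge0 => c _; exact: afac_ge0.
Qed.

Lemma prod_le_sqrtpow (F : nat -> R) (r : 'I_n -> nat) m :
  (forall j, 0 <= F j <= sqrtpow R j j) -> (\sum_(c | c != 0%R) r c)%N = m ->
  \prod_(c | c != 0) F (r c) <= sqrtpow R m m.
Proof.
move=> hF wm; apply: (@le_trans _ _ (\prod_(c < n | c != 0) Num.sqrt m%:R ^+ r c)).
  apply: ler_prod => c c0; have /andP[-> /= /le_trans] := hF (r c); apply.
  by apply: sqrtpow_le; rewrite -wm (bigD1 c) //= leq_addr.
by rewrite prodrXr wm.
Qed.

(** For fixed m this says f = O(n^(-m/2)), the reciprocal order of [level2_crude]. The factor 2
    comes from n <= 2 (n - m). *)
Lemma fhat_crude (chi : freq) m : (2 * m <= n)%N -> weight chi = m ->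
  `|fhat R chi| <= (2 * expR (1 / 2) * Num.sqrt m%:R / sqn) ^+ m.
Proof.
move=> mn wm; have s0 := sqn_gt0.
have pm : (n - m + m = n)%N by rewrite subnK //; lia.
have p_gt0 : (0 < n - m)%N by lia.
apply: le_trans (fhat_weight_le p_gt0 pm wm) _.
have hprod := @prod_le_sqrtpow (afac R) (mult chi) m _ (etrans (sum_mult_pos chi) wm).
have -> : (2 * expR (1 / 2) * Num.sqrt m%:R / sqn) ^+ m =
   expR (m%:R / 2) * (2 / sqn) ^+ m * sqrtpow R m m.
  have -> : m%:R / 2 = m%:R * (1 / 2) :> R by rewrite mul1r.
  by rewrite expR_nat_mul -!exprMn; congr (_ ^+ _); ring.
apply: ler_pM.
- by rewrite mulr_ge0 ?expR_ge0 // exprn_ge0 // divr_ge0 ?sqrtr_ge0.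
- by apply: prodr_ge0 => c _; exact: afac_ge0.
- apply: ler_wpM2l; first exact: expR_ge0.
  apply: lerXn2r; rewrite ?nnegrE ?divr_ge0 ?sqrtr_ge0 //.
  rewrite ler_pdivrMr ?ltr0n // mulrAC ler_pdivlMr // -expr2 sqn2.
  by rewrite -natrM ler_nat; lia.
- by apply: hprod => r; rewrite afac_ge0 afac_le.
Qed.

End LevelBounds.

(** * Levels with and without a dominant non-zero value; sums over types *)

Section SpreadLevels.
Variables (R : realType) (k : nat).
Local Notation n := k.+1.
Local Notation freq := {ffun 'I_n -> 'I_n}.
Local Notation sqn := (Num.sqrt n%:R : R).
Local Notation e := (expR (1 : R)).

Lemma expR1_le3 : e <= 3.
Proof.
(* Six is the least exponent that works: (6/5)^6 = 2.985984 is below 3, while (5/4)^5 is above. *)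
have h : 5 / 6 <= expR (- (1 / 6)) :> R by apply: le_trans (expR_ge1Dx _); lra.
have h6 : (5 / 6) ^+ 6 <= expR (- (1 / 6)) ^+ 6 :> R.
  by apply: lerXn2r h; rewrite nnegrE ?expR_ge0 // divr_ge0.
have e6 : expR (- (1 / 6)) ^+ 6 * e = 1.
  rewrite -expRM_natl -expRD -[RHS]expR0; congr expR; by field.
have e0 := expR_gt0 (1 : R).
have : (5 / 6) ^+ 6 * e <= 1 by rewrite -[leRHS]e6 ler_pM2r.
by rewrite -ler_pdivlMl ?exprn_gt0 ?divr_gt0 // => /le_trans; apply; lra.
Qed.

Lemma afac_exp r : (0 < r)%N -> afac R r <= e * r%:R * (Num.sqrt r%:R / e) ^+ r.
Proof.
case: r => // r _; rewrite ler_pdivrMr ?sqrtpow_gt0 //.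
rewrite expr_div_n -/(sqrtpow R r.+1 r.+1).
have -> (a b c : R) : a * (b / c) * b = a * b ^+ 2 / c by ring.
rewrite sqrtpow_sqr.
by rewrite ler_pdivlMr ?exprn_gt0 ?expR_gt0 // -expRM_natl mulr1 fact_upper.
Qed.

Lemma bfac_exp r : (0 < r)%N ->
  bfac R r <= (e * r%:R) ^+ 2 * (Num.sqrt r%:R / e ^+ 2) ^+ r.
Proof.
move=> r_gt0.
have s0 := sqrtpow_gt0 R r.
have -> : bfac R r = afac R r ^+ 2 / sqrtpow R r r.
  by rewrite /bfac /afac; field; rewrite gt_eqF.
rewrite ler_pdivrMr //.
have -> : (e * r%:R) ^+ 2 * (Num.sqrt r%:R / e ^+ 2) ^+ r * sqrtpow R r r =
    (e * r%:R * (Num.sqrt r%:R / e) ^+ r) ^+ 2.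
  rewrite [in RHS]exprMn -mulrA; congr (_ * _); rewrite /sqrtpow -exprMn -exprM mulnC exprM.
  by congr (_ ^+ _); field; rewrite gt_eqF ?expR_gt0.
by apply: lerXn2r (afac_exp r_gt0); rewrite nnegrE ?afac_ge0 // !mulr_ge0 ?exprn_ge0 ?divr_ge0 ?expR_ge0 ?sqrtr_ge0.
Qed.


(* Parts of size at most [m/12] satisfy [afac r <= beta ^ r] outright, and there
   are fewer than [12] larger parts, each losing a factor [e m]. *)
Lemma prod_afac_spread (chi : freq) m : (0 < m)%N -> weight chi = m ->
  (forall c, c != 0 -> (4 * mult chi c <= 3 * m)%N) ->
  \prod_(c | c != 0) afac R (mult chi c) <=
  (e * m%:R) ^+ 12 * (Num.sqrt (3 / 4) * Num.sqrt m%:R / e) ^+ m.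
Proof.
move=> m_gt0 wm hspread; have e0 := expR_gt0 (1 : R).
set beta := Num.sqrt (3 / 4) * _ / e.
have beta_ge0 : 0 <= beta by rewrite divr_ge0 ?mulr_ge0 ?sqrtr_ge0 ?ltW.
have m1 : 1 <= m%:R :> R by rewrite ler1n.
have em1 : 1 <= e * m%:R.
  by rewrite -[leLHS]mulr1; apply: ler_pM => //; rewrite -expR0 ler_expR.
(* beta^2 = 3m/(4 e^2) and e <= 3: this is the origin of the threshold m/12 between small and large
   parts. *)
have beta2 : m%:R / 12 <= beta ^+ 2.
  rewrite expr_div_n exprMn !sqr_sqrtr ?divr_ge0 // ler_pdivlMr ?exprn_gt0 //.
  have e2 : e ^+ 2 <= 9.
    have -> : 9 = 3 ^+ 2 :> R by ring.
    by apply: lerXn2r expR1_le3; rewrite nnegrE ?expR_ge0.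
  have -> : 3 / 4 * m%:R = m%:R / 12 * 9 :> R by field.
  by rewrite ler_wpM2l // divr_ge0.
have factor c : c != 0 ->
    0 <= afac R (mult chi c) <= (e * m%:R) ^+ (m < 12 * mult chi c)%N * beta ^+ mult chi c.
  move=> c0; rewrite afac_ge0 /=; set r := mult chi c.
  have rle : (4 * r <= 3 * m)%N := hspread c c0.
  case: ltnP => hr.
    have r0 : (0 < r)%N by case: (r) hr; rewrite ?muln0.
    apply: le_trans (afac_exp r0) _; rewrite expr1; apply: ler_pM.
    - by rewrite mulr_ge0 ?expR_ge0.
    - by rewrite exprn_ge0 // divr_ge0 ?sqrtr_ge0 ?ltW.
    - by rewrite ler_pM2l // ler_nat; lia.
    apply: lerXn2r; rewrite ?nnegrE ?divr_ge0 ?sqrtr_ge0 ?(ltW e0) //.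
    rewrite /beta ler_pM2r ?invr_gt0 // -sqrtrM ?divr_ge0 // ler_sqrt ?mulr_ge0 ?divr_ge0 //.
    by rewrite mulrAC ler_pdivlMr // -!natrM ler_nat; lia.
  rewrite expr0 mul1r; apply: le_trans (afac_le R r) _.
  apply: lerXn2r; rewrite ?nnegrE ?sqrtr_ge0 //.
  rewrite -(@ler_pXn2r _ 2) // ?nnegrE ?sqrtr_ge0 // sqr_sqrtr ?ler0n //.
  by apply: le_trans beta2; rewrite ler_pdivlMr // -natrM ler_nat mulnC.
apply: le_trans (ler_prod _ factor) _.
rewrite big_split /= prodrXr prodrXr sum_mult_pos wm.
rewrite ler_wpM2r ?exprn_ge0 //; apply: ler_weXn2l => //.
set b := (\sum_(c | _) _)%N.
have : (m * b <= 12 * m)%N.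
  have <- : (\sum_(c | c != 0%R) mult chi c = m)%N by rewrite sum_mult_pos.
  rewrite !big_distrr /=; apply: leq_sum => c c0.
  rewrite sum_mult_pos wm; case: ltnP => hr; last by rewrite muln0.
  by rewrite muln1 ltnW.
by rewrite mulnC leq_pmul2r.
Qed.

(** Supremum of |f| times [level2 m]. The constant powers of e and the powers of sqrt m cancel
    exactly; apart from n/p and e^w with w = sqrt(m/n), both near 1 for sparse levels, only
    sqrt(3/4) remains in the base. *)
Lemma level3_spread m p : (0 < m)%N -> (0 < p)%N -> (p + m = n)%N ->
  \sum_(chi : freq | (weight chi == m) && [forall c, (c != 0) ==> (4 * mult chi c <= 3 * m)%N])
     `|fhat R chi| ^+ 3 <=
  (e * m%:R) ^+ 12 *
  (n%:R / p%:R * expR (Num.sqrt m%:R / sqn) * Num.sqrt (3 / 4)) ^+ m.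
Proof.
move=> m_gt0 p_gt0 pm; have e0 := expR_gt0 (1 : R).
set w := Num.sqrt m%:R / sqn.
set S := expR (m%:R / 2) * (sqn / p%:R) ^+ m *
  ((e * m%:R) ^+ 12 * (Num.sqrt (3 / 4) * Num.sqrt m%:R / e) ^+ m).
have S_ge0 : 0 <= S.
  by rewrite !mulr_ge0 ?exprn_ge0 ?mulr_ge0 ?divr_ge0 ?expR_ge0 ?sqrtr_ge0 ?ler0n // divr_ge0 ?expR_ge0.
apply: (@le_trans _ _ (level2 R k m * S)).
  rewrite mulr_suml [leRHS](bigID (fun chi : freq => [forall c, (c != 0) ==> (4 * mult chi c <= 3 * m)%N])) /=.
  rewrite -[leLHS]addr0; apply: lerD; last first.
    by apply: sumr_ge0 => chi _; rewrite mulr_ge0 ?sqr_ge0.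
  apply: ler_sum => chi /andP[/eqP wm /forallP h].
  rewrite exprSr real_normK ?num_real // ler_wpM2l ?sqr_ge0 //.
  apply: le_trans (fhat_weight_le _ p_gt0 pm wm) _.
  apply: ler_wpM2l; first by rewrite mulr_ge0 ?expR_ge0 ?exprn_ge0 ?divr_ge0 ?sqrtr_ge0.
  by apply: prod_afac_spread => // c; apply/implyP.
have sm : 0 < sqrtpow R m m by exact: sqrtpow_gt0.
have := level2_le R k m_gt0; rewrite -ler_pdivlMr // => h.
apply: le_trans (ler_wpM2r S_ge0 h) _.
rewrite le_eqVlt; apply/orP; left; apply/eqP.
rewrite /S expRD !expR_nat_mul -/w.
have -> (a b c d f g i : R) : a ^+ m * (b ^+ m * c ^+ m) / sqrtpow R m m *
    (d ^+ m * f ^+ m * (i * (g ^+ m))) = i * ((a * b * c * d * f * g) ^+ m / sqrtpow R m m).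
  by rewrite !exprMn; ring.
congr (_ * _); rewrite /sqrtpow -expr_div_n; congr (_ ^+ _).
have -> : e = expR 2^-1 * expR 2^-1 by rewrite -expRD; congr expR; field.
rewrite -[X in _ = X / _ * _ * _]sqn2; field.
have -> : Num.sqrt m%:R != 0 :> R by rewrite gt_eqF // sqrtr_gt0 ltr0n.
have -> : p%:R != 0 :> R by rewrite pnatr_eq0 -lt0n.
by rewrite gt_eqF ?expR_gt0.
Qed.

(** Multiplicities as a function into a finite type, so that a sum over types can be enlarged to a
    sum over all functions, which factors over the values c. *)
Definition typ (chi : freq) : {ffun 'I_n -> 'I_n.+1} := [ffun c => inord (mult chi c)].

Lemma typE (chi : freq) c : typ chi c = mult chi c :> nat.
Proof. by rewrite ffunE inordK // ltnS mult_le. Qed.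

(** Each realised type is bounded by [class_fhat3_le]; vectors that are the multiplicities of no
    [chi] only add nonnegative terms. *)
Lemma sum_type_fhat3 (P : pred {ffun 'I_n -> 'I_n.+1}) :
  \sum_(chi | P (typ chi)) `|fhat R chi| ^+ 3 <=
  sqrtpow R n n ^+ 3 / (n`!)%:R ^+ 2 * \sum_(r | P r) \prod_c bfac R (r c).
Proof.
rewrite (partition_big typ P) //= mulr_sumr; apply: ler_sum => r Pr.
have [chi /eqP hchi|none] := pickP (fun chi => typ chi == r); last first.
  rewrite big1 => [|chi /andP[_]]; last by rewrite none.
  rewrite mulr_ge0 ?divr_ge0 ?exprn_ge0 ?(ltW (sqrtpow_gt0 _ _)) //.
  by apply: prodr_ge0 => c _; exact: bfac_ge0.
rewrite (eq_bigr (fun c => bfac R (mult chi c))) => [|c _]; last by rewrite -hchi typE.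
apply: le_trans (class_fhat3_le R chi).
rewrite le_eqVlt; apply/orP; left; apply/eqP; apply: eq_bigl => h.
apply/andP/forallP => [[_ /eqP hr] c|hs].
  by rewrite -!typE hr hchi.
have -> : typ h = r.
  by rewrite -hchi; apply/ffunP => c; apply/val_inj; rewrite /= !typE; apply/eqP/hs.
by rewrite eqxx.
Qed.

Lemma sum_typ (chi : freq) : (\sum_c typ chi c = n)%N.
Proof. by rewrite -[RHS](sum_mult chi); apply: eq_bigr => c _; rewrite typE. Qed.

(** Rankin's trick: every term has total multiplicity n, so weighting by y^(r_c) and dividing by y^n
    changes nothing. The constraint on the total can then be dropped, and the sum becomes an n-th
    power. *)
Lemma spread_sum_le (L : nat) (y : R) : 0 < y ->
  \sum_(chi : freq | [forall c, (mult chi c <= L)%N]) `|fhat R chi| ^+ 3 <=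
  sqrtpow R n n ^+ 3 / (n`!)%:R ^+ 2 *
  ((\sum_(r < n.+1 | (r <= L)%N) bfac R r * y ^+ r) / y) ^+ n.
Proof.
move=> y_gt0.
pose P (r : {ffun 'I_n -> 'I_n.+1}) := [forall c, (r c <= L)%N] && (\sum_c r c == n)%N.
rewrite (eq_bigl (fun chi => P (typ chi))) => [|chi]; last first.
  rewrite /P sum_typ eqxx andbT; apply: eq_forallb => c; by rewrite typE.
apply: le_trans (sum_type_fhat3 P) _.
apply: ler_wpM2l; first by rewrite divr_ge0 ?exprn_ge0 ?(ltW (sqrtpow_gt0 _ _)).
rewrite expr_div_n ler_pdivlMr ?exprn_gt0 //.
have -> : (\sum_(r < n.+1 | (r <= L)%N) bfac R r * y ^+ r) ^+ n =
   \prod_(c < n) \sum_(r < n.+1) (if (r <= L)%N then bfac R r * y ^+ r else 0).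
  by rewrite prodr_const card_ord -big_mkcond.
rewrite bigA_distr_bigA mulr_suml [leRHS](bigID P) /= -[leLHS]addr0.
apply: lerD; last first.
  apply: sumr_ge0 => r _; apply: prodr_ge0 => c _.
  by case: ifP => // _; rewrite mulr_ge0 ?bfac_ge0 ?exprn_ge0 // ltW.
apply: ler_sum => r /andP[/forallP hL /eqP hn].
under [leRHS]eq_bigr => c _ do rewrite hL.
by rewrite [leRHS]big_split /= prodrXr hn.
Qed.

Lemma bfac_main_le p m : (0 < p)%N -> (p + m = n)%N ->
  sqrtpow R n n ^+ 3 / (n`!)%:R ^+ 2 * bfac R p <=
  (expR (3 / 2) * sqn ^+ 3 / p%:R ^+ 2) ^+ m.
Proof.
move=> p_gt0 pm.
have -> : sqrtpow R n n ^+ 3 / (n`!)%:R ^+ 2 * bfac R p =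
    (sqrtpow R n n / (n`!)%:R * afac R p) ^+ 2 * (sqrtpow R n n / sqrtpow R p p).
  by rewrite /bfac /afac; field; rewrite gt_eqF ?sqrtpow_gt0 // factR_neq0.
apply: (@le_trans _ _ ((expR (m%:R / 2) * (sqn / p%:R) ^+ m) ^+ 2 * (expR (m%:R / 2) * sqn ^+ m))).
  apply: ler_pM.
  - exact: sqr_ge0.
  - by rewrite divr_ge0 // ltW // sqrtpow_gt0.
  - have h0 := ltW (sqrtpow_gt0 R n).
    apply: lerXn2r (afac_main_le R p_gt0 pm); rewrite nnegrE.
      by apply: mulr_ge0; [exact: divr_ge0|exact: afac_ge0].
    by apply: mulr_ge0; rewrite ?expR_ge0 ?exprn_ge0 ?divr_ge0 ?sqrtr_ge0.
  - exact: main_factor_le.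
rewrite expR_nat_mul -!exprMn -exprM mulnC exprM -!exprMn.
rewrite le_eqVlt; apply/orP; left; apply/eqP; congr (_ ^+ _).
have -> : expR (3 / 2) = expR 2^-1 * expR 2^-1 * expR 2^-1 :> R.
  by rewrite -!expRD; congr expR; field.
by field; rewrite pnatr_eq0 -lt0n.
Qed.

(* [x ^ 4] marks every frequency outside [{0, c}]; there are at most [m/4] of
   them, so undoing the marking costs at most [x ^- m]. *)
Lemma concentrated_sum_le p m (x : R) : (0 < m)%N -> (0 < p)%N -> (p + m = n)%N ->
  0 < x -> x < 1 ->
  \sum_(chi : freq | (weight chi == m) && [exists c, (c != 0) && (3 * m < 4 * mult chi c)%N])
     `|fhat R chi| ^+ 3 <=
  sqrtpow R n n ^+ 3 / (n`!)%:R ^+ 2 * bfac R p *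
  (n%:R * n.+1%:R * sqrtpow R m m / x ^+ m / (1 - x ^+ 4) ^+ n).
Proof.
move=> m_gt0 p_gt0 pm x_gt0 x_lt1.
have x0 : 0 <= x := ltW x_gt0.
have x4 : x ^+ 4 < 1 by rewrite exprn_ilt1.
have d0 : 0 < 1 - x ^+ 4 by rewrite subr_gt0.
have K0 : 0 <= sqrtpow R n n ^+ 3 / (n`!)%:R ^+ 2.
  by rewrite divr_ge0 ?exprn_ge0 ?(ltW (sqrtpow_gt0 _ _)).
pose Q (r : {ffun 'I_n -> 'I_n.+1}) c := [&& c != 0, (3 * m < 4 * r c)%N, r 0 == p :> nat & (\sum_c r c == n)%N].
pose P (r : {ffun 'I_n -> 'I_n.+1}) := [exists c, Q r c].
rewrite (eq_bigl (fun chi => P (typ chi))) => [|chi]; last first.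
  have -> : (weight chi == m) = (typ chi 0 == p :> nat).
    rewrite typE -(eqn_add2l (mult chi 0)) mult0_weight -pm eqn_add2r.
    by rewrite eq_sym.
  apply/andP/existsP => [[h0 /existsP[c /andP[c0 hc]]]|[c /and4P[c0 hc h0 _]]].
    by exists c; rewrite /Q c0 typE hc h0 sum_typ eqxx.
  by split=> //; apply/existsP; exists c; rewrite c0 -typE.
apply: le_trans (sum_type_fhat3 P) _.
rewrite -[leRHS]mulrA; apply: ler_wpM2l => //.
apply: (@le_trans _ _ (\sum_(c : 'I_n) \sum_(r | Q r c) \prod_c bfac R (r c))).
  rewrite (exchange_big_dep P) /=; last by move=> c r _ h; apply/existsP; exists c.
  apply: ler_sum => r /existsP[c hc]; rewrite [leRHS](bigD1 c) //= lerDl.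
  by apply: sumr_ge0 => c' _; apply: prodr_ge0 => i _; exact: bfac_ge0.
(* The product of [G] majorises each admissible type and factors over c': the multiplicity of 0 is
   pinned to p, that of the dominant value c is free at a cost of n + 1, and every other value is
   damped by x^4 per occurrence. *)
pose G (c c' : 'I_n) (j : 'I_n.+1) : R :=
  if c' == 0 then (j == p :> nat)%:R else if c' == c then 1 else (x ^+ 4) ^+ j.
have G0 c c' j : 0 <= G c c' j.
  by rewrite /G; case: ifP => // _; case: ifP => // _; rewrite !exprn_ge0.
pose B := bfac R p * sqrtpow R m m / x ^+ m.
have B0 : 0 <= B by rewrite divr_ge0 ?exprn_ge0 // mulr_ge0 ?bfac_ge0 // ltW // sqrtpow_gt0.
have one c (r : {ffun 'I_n -> 'I_n.+1}) : Q r c -> \prod_c bfac R (r c) <= B * \prod_c' G c c' (r c').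
  move=> /and4P[c0 hc /eqP h0 /eqP hn].
  have hm : (\sum_(c' | c' != 0%R) r c' = m)%N.
    by apply: (@addnI p); rewrite pm -[RHS]hn [RHS](bigD1 0%R) //= h0.
  have hj : (4 * \sum_(c' | (c' != 0%R) && (c' != c)) r c' <= m)%N.
    by move: hm; rewrite (bigD1 c) //=; lia.
  rewrite (bigD1 0) //= h0 /B -mulrA -mulrA; apply: ler_wpM2l; first exact: bfac_ge0.
  have hb : \prod_(c' | c' != 0) bfac R (r c') <= sqrtpow R m m.
    by apply: prod_le_sqrtpow hm => j; rewrite bfac_ge0 bfac_le.
  apply: le_trans hb _; rewrite -[leLHS]mulr1; apply: ler_wpM2l; first by rewrite ltW ?sqrtpow_gt0.
  rewrite mulrC ler_pdivlMr ?exprn_gt0 // mul1r.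
  rewrite (bigD1 0) //= (bigD1 c) //= {1 2}/G eqxx (negbTE c0) eqxx h0 eqxx !mul1r.
  rewrite (eq_bigr (fun c' => (x ^+ 4) ^+ r c')); last first.
    by move=> c' /andP[h1 h2]; rewrite /G (negbTE h1) (negbTE h2).
  by rewrite prodrXr -exprM; apply: ler_wiXn2l => //; exact: ltW.
have geo : \sum_(j < n.+1) (x ^+ 4) ^+ j <= (1 - x ^+ 4)^-1.
  rewrite -[leRHS]mul1r ler_pdivlMr // mulrC -[1 - _]opprB mulNr -subrX1 opprB.
  by rewrite lerBlDr lerDl !exprn_ge0.
have d1 : 1 <= (1 - x ^+ 4)^-1 by rewrite invf_ge1 // lerBlDr lerDl exprn_ge0.
have all c : c != 0 -> \sum_(r : {ffun 'I_n -> 'I_n.+1}) \prod_c' G c c' (r c') <= n.+1%:R / (1 - x ^+ 4) ^+ n.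
  move=> c0; rewrite -bigA_distr_bigA.
  have step c' : 0 <= \sum_j G c c' j <= (if c' == c then n.+1%:R else 1) * (1 - x ^+ 4)^-1.
    rewrite sumr_ge0 //= /G; case: (eqVneq c' 0) => [->|c'0].
      rewrite eq_sym (negbTE c0) mul1r.
      have pn : (p < n.+1)%N by rewrite ltnS -pm leq_addr.
      rewrite (bigD1 (Ordinal pn)) //= eqxx big1 ?addr0 // => j.
      by rewrite -val_eqE /= => /negbTE ->.
    case: (eqVneq c' c) => _; last by rewrite mul1r.
    by rewrite sumr_const card_ord -[leLHS]mulr1 ler_wpM2l.
  apply: (@le_trans _ _ (\prod_(c' < n) ((if c' == c then n.+1%:R else 1) * (1 - x ^+ 4)^-1))).
    by apply: ler_prod => c' _; exact: step.
  rewrite big_split /= prodr_const card_ord (bigD1 c) //= eqxx big1 ?mulr1 ?exprVn //.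
  by move=> c' /negbTE ->.
apply: (@le_trans _ _ (\sum_(c : 'I_n) B * (n.+1%:R / (1 - x ^+ 4) ^+ n))).
  apply: ler_sum => c _; have [c0|c0] := eqVneq c 0.
    rewrite big_pred0 => [|r]; last by rewrite /Q c0 eqxx.
    by rewrite mulr_ge0 // divr_ge0 // exprn_ge0 // ltW.
  apply: le_trans (ler_sum _ (one c)) _; rewrite -mulr_sumr ler_wpM2l //.
  apply: le_trans (all c c0); rewrite [leRHS](bigID (fun r => Q r c)) /= lerDl.
  by apply: sumr_ge0 => r _; apply: prodr_ge0.
rewrite sumr_const card_ord -mulr_natl /B le_eqVlt; apply/orP; left; apply/eqP.
by ring.
Qed.

End SpreadLevels.

Ltac nneg := repeat first [ assumption | exact: ler01 | exact: ler0n | exact: expR_ge0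
  | exact: sqrtr_ge0 | exact: normr_ge0 | (apply: ltW; assumption) | apply: exprn_ge0
  | apply: mulr_ge0 | rewrite invr_ge0 | apply: addr_ge0 ].

(** * A geometric bound for the sparse levels, uniform in n *)

Section LevelDomination.
Variables (R : realType) (k : nat).
Local Notation n := k.+1.
Local Notation freq := {ffun 'I_n -> 'I_n}.
Local Notation sqn := (Num.sqrt n%:R : R).
Local Notation e := (expR (1 : R)).

Definition level3 (m : nat) : R := \sum_(chi : freq | weight chi == m) fhat R chi ^+ 3.

Lemma level3_concentrated p m : (0 < m)%N -> (p + m = n)%N -> (n <= 2 * p)%N ->
  \sum_(chi : freq | (weight chi == m) && [exists c, (c != 0) && (3 * m < 4 * mult chi c)%N])
     `|fhat R chi| ^+ 3 <=
  n%:R * n.+1%:R * (4 * expR (7 / 2) * Num.sqrt (Num.sqrt m%:R / sqn)) ^+ m.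
Proof.
move=> m_gt0 pm np; have p_gt0 : (0 < p)%N by lia.
have mR : 0 < m%:R :> R by rewrite ltr0n.
have pR : 0 < p%:R :> R by rewrite ltr0n.
have nR : 0 < n%:R :> R by rewrite ltr0n.
have s0 : 0 < sqn by exact: sqn_gt0.
have sm0 : 0 < Num.sqrt m%:R :> R by rewrite sqrtr_gt0.
(* With x^4 = m/n one has 1 - x^4 = p/n, so (1 - x^4)^(-n) is at most e^(2m). The base of the m-th
   power is of order sqrt(m/n)/x = x, so undoing the marking still leaves one factor x per entry. *)
set x : R := Num.sqrt (Num.sqrt m%:R / sqn).
have x_gt0 : 0 < x by rewrite sqrtr_gt0 divr_gt0.
have x2 : x ^+ 2 = Num.sqrt m%:R / sqn by rewrite sqr_sqrtr // divr_ge0 // ltW.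
have x4 : x ^+ 4 = m%:R / n%:R.
  by rewrite (exprM x 2 2) x2 expr_div_n !sqr_sqrtr ?ler0n.
have x_lt1 : x < 1.
  rewrite -(@ltr_pXn2r _ 4) ?nnegrE ?(ltW x_gt0) // x4 expr1n ltr_pdivrMr // mul1r.
  by rewrite ltr_nat; lia.
have hconc := concentrated_sum_le m_gt0 p_gt0 pm x_gt0 x_lt1.
apply: le_trans hconc _.
have omx : 1 - x ^+ 4 = p%:R / n%:R.
  by rewrite x4 -[in n%:R]pm natrD; field; rewrite -natrD pm pnatr_eq0.
have inv_le : (1 - x ^+ 4) ^- n <= expR 2 ^+ m.
  rewrite omx -exprVn invf_div -expRM_natl.
  have h : n%:R / p%:R <= expR (m%:R / p%:R) :> R.
    apply: le_trans (expR_ge1Dx _).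
    by rewrite -pm natrD mulrDl divff ?gt_eqF.
  apply: (@le_trans _ _ (expR (m%:R / p%:R) ^+ n)).
    by apply: lerXn2r h; rewrite nnegrE ?expR_ge0 // divr_ge0.
  rewrite -expRM_natl ler_expR mulrCA ler_pM2l //.
  by rewrite ler_pdivrMr // -natrM ler_nat.
have b0 := bfac_main_le R p_gt0 pm.
set A := (expR (3 / 2) * sqn ^+ 3 / p%:R ^+ 2) in b0.
have A0 : 0 <= A by rewrite divr_ge0 ?mulr_ge0 ?expR_ge0 ?exprn_ge0 // ltW.
have nn0 : 0 <= n%:R * n.+1%:R :> R by rewrite mulr_ge0.
have sx0 : 0 <= sqrtpow R m m / x ^+ m by rewrite divr_ge0 ?exprn_ge0 // ltW.
rewrite -[_ * sqrtpow R m m / _]mulrA.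
apply: (@le_trans _ _ (A ^+ m * (n%:R * n.+1%:R * (sqrtpow R m m / x ^+ m) * expR 2 ^+ m))).
  apply: ler_pM b0 _.
  - by rewrite mulr_ge0 ?bfac_ge0 // divr_ge0 ?exprn_ge0 ?(ltW (sqrtpow_gt0 _ _)).
  - by rewrite omx; apply: divr_ge0; [exact: mulr_ge0|rewrite exprn_ge0 // divr_ge0].
  by apply: ler_wpM2l => //; rewrite mulr_ge0.
have -> : A ^+ m * (n%:R * n.+1%:R * (sqrtpow R m m / x ^+ m) * expR 2 ^+ m) =
   n%:R * n.+1%:R * (A * (Num.sqrt m%:R / x) * expR 2) ^+ m.
  by rewrite -(expr_div_n (Num.sqrt m%:R) x m) -[n%:R * n.+1%:R * _ * _]mulrA mulrCA -!exprMn mulrA.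
apply: ler_wpM2l => //; apply: lerXn2r.
- by rewrite nnegrE mulr_ge0 ?expR_ge0 // mulr_ge0 // divr_ge0 // ltW.
- by rewrite nnegrE mulr_ge0 ?mulr_ge0 ?expR_ge0 // ltW.
have -> : Num.sqrt m%:R = x ^+ 2 * sqn by rewrite x2 divfK ?gt_eqF.
have -> : A * (x ^+ 2 * sqn / x) * expR 2 = (sqn ^+ 2) ^+ 2 / p%:R ^+ 2 * (expR (3 / 2) * expR 2) * x.
  by rewrite /A; field; rewrite !gt_eqF.
rewrite sqn2 -expRD; have -> : 3 / 2 + 2 = 7 / 2 :> R by field.
rewrite ler_pM2r // ler_pM2r ?expR_gt0 // ler_pdivrMr ?exprn_gt0 //.
have -> : 4 * p%:R ^+ 2 = (2 * p%:R) ^+ 2 :> R by ring.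
by apply: lerXn2r; rewrite ?nnegrE // -natrM ler_nat.
Qed.

Lemma level3_split m p : (0 < m)%N -> (p + m = n)%N -> (n <= 2 * p)%N ->
  `|level3 m| <=
  (e * m%:R) ^+ 12 *
    (n%:R / p%:R * expR (Num.sqrt m%:R / sqn) * Num.sqrt (3 / 4)) ^+ m +
  n%:R * n.+1%:R * (4 * expR (7 / 2) * Num.sqrt (Num.sqrt m%:R / sqn)) ^+ m.
Proof.
move=> m_gt0 pm np; have p_gt0 : (0 < p)%N by lia.
apply: (@le_trans _ _ (\sum_(chi : freq | weight chi == m) `|fhat R chi| ^+ 3)).
  apply: le_trans (ler_norm_sum _ _ _) _.
  by rewrite le_eqVlt; apply/orP; left; apply/eqP; apply: eq_bigr => chi _; rewrite normrX.
rewrite (bigID (fun chi : freq => [forall c, (c != 0) ==> (4 * mult chi c <= 3 * m)%N])) /=.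
apply: lerD; first exact: level3_spread.
apply: le_trans (level3_concentrated m_gt0 pm np).
rewrite le_eqVlt; apply/orP; left; apply/eqP; apply: eq_bigl => chi.
rewrite negb_forall; congr (_ && _); apply: eq_existsb => c.
by rewrite negb_imply ltnNge.
Qed.

End LevelDomination.

Section Domination.
Variable R : realType.
Local Notation e := (expR (1 : R)).

(* Levels [m <= eta ^ 4 * n] are treated as sparse. *)
Definition eta : R := (1 / 10) ^+ 3.

Lemma expR_le_inv (w : R) : w < 1 -> expR w <= (1 - w)^-1.
Proof.
move=> w1; have d : 0 < 1 - w by rewrite subr_gt0.
by rewrite -[expR w]invrK -expRN lef_pV2 ?posrE ?expR_gt0 // expR_ge1Dx.
Qed.

(** The first factor adds the spread and the concentrated contributions, both bounded by multiples
    of (e m)^12 (9/10)^m. The second pays for the polynomial: 9/10 = (18/19)(19/20), and (m/19)^12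
    (18/19)^m <= 12!. *)
Definition domconst : R :=
  (1 + 2 * (4 * expR (7 / 2)) ^+ 8 * 2 ^+ 8) * ((19 * e) ^+ 12 * (12`!)%:R).

Lemma level3_dominated k m : (8 <= m)%N -> m%:R <= eta ^+ 4 * k.+1%:R ->
  `|level3 R k m| <= domconst * (19 / 20) ^+ m.
Proof.
move=> m8; set n := k.+1 => mle.
have m_gt0 : (0 < m)%N by lia.
have mR : 0 < m%:R :> R by rewrite ltr0n.
have nR : 0 < n%:R :> R by rewrite ltr0n.
have m2n : (2 * m <= n)%N.
  by rewrite -(ler_nat R) natrM; move: mle nR; rewrite /eta; lra.
set p := (n - m)%N; have pm : (p + m = n)%N by rewrite subnK //; lia.
have np : (n <= 2 * p)%N by lia.
have pR : 0 < p%:R :> R by rewrite ltr0n; lia.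
apply: le_trans (level3_split R m_gt0 pm np) _.
set sqn : R := Num.sqrt n%:R; have s0 : 0 < sqn by exact: sqn_gt0.
have eta0 : 0 < eta by rewrite /eta; lra.
have wle : Num.sqrt m%:R / sqn <= eta ^+ 2.
  rewrite ler_pdivrMr // -(@ler_pXn2r _ 2) ?nnegrE ?mulr_ge0 ?exprn_ge0 ?sqrtr_ge0 ?(ltW eta0) //.
  by rewrite exprMn sqn2 sqr_sqrtr ?ler0n // -exprM.
have xle : Num.sqrt (Num.sqrt m%:R / sqn) <= eta.
  rewrite -(@ler_pXn2r _ 2) ?nnegrE ?sqrtr_ge0 ?(ltW eta0) //.
  by rewrite sqr_sqrtr // divr_ge0 ?sqrtr_ge0.
set w := Num.sqrt m%:R / sqn in wle *; set x := Num.sqrt w in xle *.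
have w0 : 0 <= w by rewrite divr_ge0 ?sqrtr_ge0.
have q0 : 0 <= Num.sqrt (3 / 4) :> R by exact: sqrtr_ge0.
have qle : Num.sqrt (3 / 4) <= 7 / 8 :> R.
  by rewrite -(@ler_pXn2r _ 2) ?nnegrE ?sqr_sqrtr //; lra.
have r1 : n%:R / p%:R <= 101 / 100 :> R.
  rewrite ler_pdivrMr //; have : n%:R = p%:R + m%:R :> R by rewrite -pm natrD.
  by move: mle; rewrite /eta; lra.
have r2 : expR w <= 101 / 100.
  apply: le_trans (expR_le_inv _) _; first by move: wle; rewrite /eta; lra.
  rewrite -[leRHS]invrK lef_pV2 ?posrE; move: wle; rewrite /eta; lra.
have base : n%:R / p%:R * expR w * Num.sqrt (3 / 4) <= 9 / 10.
  apply: (@le_trans _ _ (101 / 100 * (101 / 100) * (7 / 8))); last by lra.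
  by apply: ler_pM => //; rewrite ?mulr_ge0 ?divr_ge0 ?expR_ge0 //; apply: ler_pM; rewrite ?divr_ge0 ?expR_ge0.
have base0 : 0 <= n%:R / p%:R * expR w * Num.sqrt (3 / 4) by rewrite !mulr_ge0 ?expR_ge0 // invr_ge0.
have em1 : 1 <= e * m%:R.
  by rewrite -[leLHS]mulr1; apply: ler_pM => //; [rewrite -expR0 ler_expR|rewrite ler1n].
set Z := (e * m%:R) ^+ 12 * (9 / 10) ^+ m.
have Z0 : 0 <= Z by rewrite mulr_ge0 ?exprn_ge0 ?divr_ge0 // (le_trans ler01).
have t1 : (e * m%:R) ^+ 12 * (n%:R / p%:R * expR w * Num.sqrt (3 / 4)) ^+ m <= Z.
  apply: ler_wpM2l; first by rewrite exprn_ge0 // (le_trans ler01).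
  by apply: lerXn2r base; rewrite nnegrE.
have e72 : expR (7 / 2) <= 81 :> R.
  apply: (@le_trans _ _ (e ^+ 4)).
    by rewrite -expRM_natl mulr1 ler_expR; lra.
  have -> : 81 = 3 ^+ 4 :> R by ring.
  by apply: lerXn2r (expR1_le3 R); rewrite nnegrE ?expR_ge0.
have kap0 : 0 <= 4 * expR (7 / 2) :> R by rewrite mulr_ge0 ?expR_ge0.
have x0 : 0 <= x by exact: sqrtr_ge0.
(* 4 * 81 * eta = 0.324: this is the binding constraint on the size of [eta]. The threshold eta^4 n
   for m makes x = (m/n)^(1/4) at most [eta]. *)
have kx : 4 * expR (7 / 2) * x <= 1 / 2.
  apply: (@le_trans _ _ (4 * 81 * eta)); last by rewrite /eta; lra.
  by apply: ler_pM => //; apply: ler_wpM2l.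
have t2 : n%:R * n.+1%:R * (4 * expR (7 / 2) * x) ^+ m <=
    2 * (4 * expR (7 / 2)) ^+ 8 * 2 ^+ 8 * Z.
  (* Eight of the m factors x give m^2/n^2, which cancels n (n + 1) up to a constant; hence the
     assumption m >= 8. *)
  have x8 : x ^+ 8 = m%:R ^+ 2 / n%:R ^+ 2.
    by rewrite (exprM x 2 4) sqr_sqrtr // (exprM w 2 2) !expr_div_n !sqr_sqrtr ?ler0n.
  have n1 : n.+1%:R <= 2 * n%:R :> R.
    by rewrite -natr1; have : 1 <= n%:R :> R by [rewrite ler1n]; lra.
  have -> : (4 * expR (7 / 2) * x) ^+ m = (4 * expR (7 / 2)) ^+ 8 * x ^+ 8 * (4 * expR (7 / 2) * x) ^+ (m - 8).
    by rewrite -[in LHS](subnKC m8) exprD exprMn.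
  rewrite x8.
  have h1 : (4 * expR (7 / 2) * x) ^+ (m - 8) <= 2 ^+ 8 * (1 / 2) ^+ m.
    apply: (@le_trans _ _ ((1 / 2) ^+ (m - 8))).
      by apply: lerXn2r kx; rewrite nnegrE ?mulr_ge0.
    have -> : (1 / 2) ^+ m = (1 / 2) ^+ 8 * (1 / 2) ^+ (m - 8) :> R by rewrite -exprD subnKC.
    have -> (t : R) : 2 ^+ 8 * ((1 / 2) ^+ 8 * t) = t by field.
    by [].
  have h2 : m%:R ^+ 2 * (1 / 2) ^+ m <= Z.
    apply: ler_pM; rewrite ?exprn_ge0 ?divr_ge0 //.
      apply: (@le_trans _ _ ((e * m%:R) ^+ 2)); last by apply: ler_weXn2l.
      apply: lerXn2r; rewrite ?nnegrE ?mulr_ge0 ?expR_ge0 // -[leLHS]mul1r ler_wpM2r //.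
      by rewrite -expR0 ler_expR.
    by apply: lerXn2r; rewrite ?nnegrE ?divr_ge0 //; lra.
  set K8 := (4 * expR (7 / 2)) ^+ 8.
  have K80 : 0 <= K8 by exact: exprn_ge0.
  set Y := (_ ^+ (m - 8)) in h1 *.
  have Y0 : 0 <= Y by rewrite exprn_ge0 // mulr_ge0.
  apply: (@le_trans _ _ (n%:R * (2 * n%:R) * (K8 * (m%:R ^+ 2 / n%:R ^+ 2) * (2 ^+ 8 * (1 / 2) ^+ m)))).
    apply: ler_pM.
    - by nneg.
    - by nneg.
    - by apply: ler_wpM2l.
    - by apply: ler_wpM2l => //; nneg.
  have -> : n%:R * (2 * n%:R) * (K8 * (m%:R ^+ 2 / n%:R ^+ 2) * (2 ^+ 8 * (1 / 2) ^+ m)) =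
     2 * K8 * 2 ^+ 8 * (m%:R ^+ 2 * (1 / 2) ^+ m) :> R by field; rewrite gt_eqF.
  by apply: ler_wpM2l => //; nneg.
apply: le_trans (lerD t1 t2) _; rewrite -[X in X + _]mul1r -mulrDl /domconst -[leRHS]mulrA.
apply: ler_wpM2l; first by nneg.
have -> : Z = ((19 * e) ^+ 12) * ((m%:R / 19) ^+ 12 * (18 / 19) ^+ m) * (19 / 20) ^+ m.
  have -> : (19 * e) ^+ 12 * ((m%:R / 19) ^+ 12 * (18 / 19) ^+ m) * (19 / 20) ^+ m =
    (19 * e * (m%:R / 19)) ^+ 12 * (18 / 19 * (19 / 20)) ^+ m by rewrite !exprMn; ring.
  by rewrite /Z; congr (_ ^+ _ * _ ^+ _); field.
rewrite ler_wpM2r ?exprn_ge0 ?divr_ge0 //; apply: ler_wpM2l; first by rewrite exprn_ge0 // mulr_ge0 ?expR_ge0.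
have h := @pow_le_fact_exp R (m%:R / 19) 12 (divr_ge0 (ler0n _ _) (ler0n _ _)).
have h' : (18 / 19) ^+ m <= expR (- (m%:R / 19)) :> R.
  rewrite -mulrN expR_nat_mul; apply: lerXn2r; rewrite ?nnegrE ?expR_ge0 ?divr_ge0 //.
  by apply: le_trans (expR_ge1Dx _); lra.
apply: (@le_trans _ _ ((12`!)%:R * expR (m%:R / 19) * expR (- (m%:R / 19)))).
  by apply: ler_pM => //; rewrite ?exprn_ge0 ?divr_ge0.
by rewrite -mulrA -expRD subrr expR0 mulr1.
Qed.

End Domination.

(** * The limit of each level *)

Section LevelRecursion.
Variables (R : realType) (k : nat).
Local Notation n := k.+1.
Local Notation freq := {ffun 'I_n -> 'I_n}.

(** Inverse of [merge] on opposite entries: it puts v and -v at two positions, which are zeros of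
    [psi] when it is used. *)
Definition split_pair (psi : freq) (i j v : 'I_n) : freq :=
  [ffun l => if l == i then v else if l == j then - v else psi l].

Lemma weight_sum (chi : freq) : weight chi = (\sum_l (chi l != 0%R))%N.
Proof.
rewrite /weight -sum1_card big_mkcond; apply: eq_bigr => l _; rewrite inE.
by case: ifP.
Qed.

Lemma weight_split_pair (psi : freq) i j v : j != i -> v != 0 ->
  psi i = 0 -> psi j = 0 -> weight (split_pair psi i j v) = (weight psi).+2.
Proof.
move=> ji v0 pi0 pj0; rewrite !weight_sum (bigD1 i) // (bigD1 j) //=.
rewrite [in RHS](bigD1 i) // [in RHS](bigD1 j) //= !ffunE eqxx (negbTE ji) eqxx.
rewrite oppr_eq0 v0 pi0 pj0 eqxx !add0n !add1n; congr _.+2.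
by apply: eq_bigr => l /andP[li lj]; rewrite ffunE (negbTE li) (negbTE lj).
Qed.

Lemma merge_split_pair (psi : freq) i j v : j != i -> psi i = 0 -> psi j = 0 ->
  merge (split_pair psi i j v) i j = psi.
Proof.
move=> ji pi0 pj0; apply/ffunP => l; rewrite !ffunE eqxx (negbTE ji) eqxx subrr.
by case: eqVneq => [->|_]; [rewrite pi0|case: eqVneq => [->|]; rewrite ?pj0].
Qed.

Lemma split_pair_merge (chi : freq) i j : j != i -> chi j = - chi i ->
  split_pair (merge chi i j) i j (chi i) = chi.
Proof.
move=> ji cj; apply/ffunP => l; rewrite !ffunE.
by case: eqVneq => [->|_] //; case: eqVneq => [->|].
Qed.

Lemma sum_opposite_pair (m : nat) (g : freq -> 'I_n -> R) i j : j != i ->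
  \sum_(chi : freq | [&& weight chi == m.+2, chi i != 0 & chi j == - chi i]) g (merge chi i j) (chi i) =
  \sum_(v | v != 0) \sum_(psi : freq | [&& weight psi == m, psi i == 0 & psi j == 0]) g psi v.
Proof.
move=> ji; rewrite (partition_big (fun chi : freq => chi i) (fun v => v != 0)) /=; last first.
  by move=> chi /and3P[].
apply: eq_bigr => v v0.
rewrite (reindex_onto (fun psi => split_pair psi i j v) (fun chi => merge chi i j)) /=; last first.
  move=> chi /andP[/and3P[_ _ /eqP cj] /eqP <-]; exact: split_pair_merge.
have key psi : [&& weight (split_pair psi i j v) == m.+2, split_pair psi i j v i != 0
     & split_pair psi i j v j == - split_pair psi i j v i]
    && (split_pair psi i j v i == v) && (merge (split_pair psi i j v) i j == psi) =
    [&& weight psi == m, psi i == 0 & psi j == 0].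
  apply/idP/and3P => [/andP[/andP[/and3P[hw _ _] _] /eqP hm]|[/eqP hw /eqP pi0 /eqP pj0]].
    have pi0 : psi i = 0 by rewrite -hm ffunE eqxx.
    have pj0 : psi j = 0.
      by rewrite -hm !ffunE (negbTE ji) eqxx !eqxx subrr.
    by move: hw; rewrite weight_split_pair // pi0 pj0 eqxx !eqSS.
  rewrite weight_split_pair // merge_split_pair // hw eqxx !ffunE eqxx (negbTE ji) eqxx.
  by rewrite v0 !eqxx.
rewrite (eq_bigl _ _ key); apply: eq_bigr => psi /and3P[_ /eqP pi0 /eqP pj0].
by rewrite merge_split_pair // ffunE eqxx.
Qed.

(** Through [split_pair], the left side counts each [psi] of weight m with a value v and an ordered
    pair of distinct zeros of [psi]. There are q + 1 zeros, hence (q + 1) q pairs. *)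
Lemma sum_opposite_pairs (m q : nat) (g : freq -> 'I_n -> R) : (q + m.+1 = n)%N ->
  \sum_(chi : freq | weight chi == m.+2) \sum_(i | chi i != 0)
     \sum_(j | (j != i) && (chi j == - chi i)) g (merge chi i j) (chi i) =
  (q.+1 * q)%:R * \sum_(psi : freq | weight psi == m) \sum_(v | v != 0) g psi v.
Proof.
move=> qm.
transitivity (\sum_i \sum_(j | j != i) \sum_(v | v != 0)
    \sum_(psi : freq | [&& weight psi == m, psi i == 0 & psi j == 0]) g psi v).
  rewrite (exchange_big_dep xpredT) //=; apply: eq_bigr => i _.
  rewrite (exchange_big_dep (fun j => j != i)) /=; last by move=> chi j _ /andP[].
  apply: eq_bigr => j ji; rewrite -sum_opposite_pair //.
  by apply: eq_bigl => chi; rewrite ji /= andbA.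
under eq_bigr => i _.
  under eq_bigr => j _.
    rewrite exchange_big /= (eq_bigl (fun psi => (weight psi == m) && ((psi i == 0) && (psi j == 0)))) //.
    rewrite big_mkcondr /=.
    under eq_bigr => psi _.
      have -> : (if (psi i == 0) && (psi j == 0) then \sum_(v | v != 0) g psi v else 0) =
        \sum_(v | v != 0) g psi v * ((psi i == 0) && (psi j == 0))%:R.
        by case: ifP => _; rewrite -mulr_suml ?mulr1 ?mulr0.
      rewrite -mulr_suml.
      over.
    over.
  rewrite exchange_big /=.
  over.
rewrite exchange_big /= mulr_sumr; apply: eq_bigr => psi /eqP wpsi.
under eq_bigr => i _ do rewrite -mulr_sumr.
rewrite -mulr_sumr mulrC; congr (_ * _).
have zpsi : mult psi 0 = q.+1.
  by apply/eqP; rewrite -(eqn_add2r m) -{1}wpsi mult0_weight addSnnS qm.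
rewrite (bigID (fun i => psi i == 0)) /= [X in _ + X]big1 ?addr0; last first.
  by move=> i /negbTE hi; rewrite big1 // => j _; rewrite hi.
rewrite (eq_bigr (fun=> q%:R)).
  rewrite sumr_const -/(mult psi 0) zpsi natrM mulrC mulr_natr; congr (_ *+ _).
move=> i hi; rewrite hi /=.
rewrite -natr_sum; congr _%:R; apply: (@addnI 1); rewrite [RHS]add1n -zpsi.
rewrite /mult -sum1_card [RHS]big_mkcond /= [RHS](bigD1 i) //= inE hi; congr (_ + _)%N.
Qed.

End LevelRecursion.

(** * The approximate recursion between the levels m + 2 and m *)

Section RecursionBound.
Variables (R : realType).

(** With U the sum, U^3 - sum u_j^3 = sum (U + u_j) u_j (U - u_j), and U - u_j runs over the other
    indices. The factor [#|A|.-1] is essential: it vanishes when only one coordinate is opposite. *)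
Lemma cube_sum_diff_le (I : finType) (A : pred I) (u : I -> R) (B : R) :
  (forall j, A j -> `|\sum_(l | A l) u l + u j| <= B) ->
  `|(\sum_(j | A j) u j) ^+ 3 - \sum_(j | A j) u j ^+ 3| <=
  B * \sum_(j | A j) u j ^+ 2 * #|A|.-1%:R.
Proof.
move=> hB; set U := \sum_(j | A j) u j in hB *.
have step j : A j -> U - u j = \sum_(l | A l && (l != j)) u l.
  by move=> Aj; rewrite /U (bigD1 j) //= addrAC subrr add0r.
have -> : U ^+ 3 - \sum_(j | A j) u j ^+ 3 = \sum_(j | A j) (U + u j) * (u j * (U - u j)).
  rewrite exprS {1}/U mulr_suml -sumrB; apply: eq_bigr => j _; ring.
apply: (@le_trans _ _ (\sum_(j | A j) \sum_(l | A l && (l != j)) B * ((u j ^+ 2 + u l ^+ 2) / 2))).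
  apply: le_trans (ler_norm_sum _ _ _) _; apply: ler_sum => j Aj.
  rewrite normrM -mulr_sumr; apply: ler_pM => //; first exact: hB.
  rewrite step // mulr_sumr; apply: le_trans (ler_norm_sum _ _ _) _.
  apply: ler_sum => l _; rewrite normrM.
  have := sqr_ge0 (`|u j| - `|u l|); rewrite -[u j ^+ 2]real_normK ?num_real // -[u l ^+ 2]real_normK ?num_real //.
  by move: `|u j| `|u l| => a b; rewrite sqrrB; lra.
have card1 j : A j -> \sum_(l | A l && (l != j)) 1 = #|A|.-1%:R :> R.
  move=> Aj; have jA : j \in A by exact: Aj.
  rewrite sumr_const [in RHS](cardD1 j A) jA add1n /=.
  by congr _%:R; apply: eq_card => l; rewrite !inE andbC.
have dbl : \sum_(j | A j) \sum_(l | A l && (l != j)) u l ^+ 2 =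
    \sum_(j | A j) \sum_(l | A l && (l != j)) u j ^+ 2.
  rewrite (exchange_big_dep A) /=; last by move=> j l _ /andP[].
  by apply: eq_bigr => l Al; apply: eq_bigl => j; rewrite Al /= eq_sym.
rewrite le_eqVlt; apply/orP; left; apply/eqP.
transitivity (B * ((\sum_(j | A j) \sum_(l | A l && (l != j)) u j ^+ 2 +
     \sum_(j | A j) \sum_(l | A l && (l != j)) u l ^+ 2) / 2)).
  rewrite -big_split /= mulr_suml mulr_sumr; apply: eq_bigr => j _.
  by rewrite -big_split /= mulr_suml mulr_sumr.
rewrite dbl; congr (_ * _).
have -> (x : R) : (x + x) / 2 = x by field.
apply: eq_bigr => j Aj; rewrite -(card1 j Aj) mulr_sumr.
by apply: eq_bigr => l _; rewrite mulr1.
Qed.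

Lemma sqr_sum_le (I : finType) (A : pred I) (u : I -> R) (N : nat) : (#|A| <= N)%N ->
  (\sum_(j | A j) u j) ^+ 2 <= N%:R * \sum_(j | A j) u j ^+ 2.
Proof.
move=> hN.
have pt j l : u j * u l <= (u j ^+ 2 + u l ^+ 2) / 2.
  by have := sqr_ge0 (u j - u l); rewrite sqrrB; lra.
rewrite expr2 mulr_suml.
apply: (@le_trans _ _ (\sum_(j | A j) \sum_(l | A l) (u j ^+ 2 + u l ^+ 2) / 2)).
  by apply: ler_sum => j _; rewrite mulr_sumr; apply: ler_sum => l _.
have S0 : 0 <= \sum_(j | A j) u j ^+ 2 by apply: sumr_ge0 => j _; exact: sqr_ge0.
apply: (@le_trans _ _ (#|A|%:R * \sum_(j | A j) u j ^+ 2)); last first.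
  by rewrite ler_wpM2r // ler_nat.
rewrite le_eqVlt; apply/orP; left; apply/eqP.
transitivity ((\sum_(j | A j) \sum_(l | A l) u j ^+ 2 + \sum_(j | A j) \sum_(l | A l) u l ^+ 2) / 2).
  by rewrite -big_split /= mulr_suml; apply: eq_bigr => j _; rewrite -big_split /= mulr_suml.
rewrite [X in X + _]exchange_big /= !sumr_const -[X in (X + _) / 2]mulr_natl.
by rewrite -[X in _ + X]mulr_natl; field.
Qed.

Lemma cube_perturb (qf U E B : R) : qf = - (U + E) -> `|E| <= B ->
  `|qf ^+ 3 + U ^+ 3| <= B * (3 / 2 * (qf ^+ 2 + U ^+ 2)).
Proof.
move=> hqf hE.
have -> : qf ^+ 3 + U ^+ 3 = - E * (qf ^+ 2 - qf * U + U ^+ 2) by rewrite hqf; ring.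
rewrite normrM normrN; apply: ler_pM => //.
rewrite ger0_norm; have h1 := sqr_ge0 (qf + U); have h2 := sqr_ge0 (qf - U).
  by move: h1; rewrite sqrrD; lra.
by move: h2; rewrite sqrrB; have := sqr_ge0 qf; have := sqr_ge0 U; lra.
Qed.

Section Step.
Variables (k m q : nat).
Local Notation n := k.+1.
Local Notation freq := {ffun 'I_n -> 'I_n}.
Hypothesis qm : (q + m.+1 = n)%N.

Lemma weight_merge (chi : freq) i j : j != i -> chi i != 0 -> chi j != 0 ->
  chi i + chi j != 0 -> weight chi = (weight (merge chi i j)).+1.
Proof.
move=> ji ci cj cij; rewrite !weight_sum (bigD1 i) // (bigD1 j) //=.
rewrite [in RHS](bigD1 i) // [in RHS](bigD1 j) //= !ffunE eqxx (negbTE ji) eqxx.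
rewrite eqxx ci cj cij add0n !add1n; congr _.+2.
by apply: eq_bigr => l /andP[li lj]; rewrite ffunE (negbTE li) (negbTE lj).
Qed.

Lemma weight_merge_opp (chi : freq) i j : j != i -> chi i != 0 -> chi j = - chi i ->
  weight chi = (weight (merge chi i j)).+2.
Proof.
move=> ji ci cj; rewrite -{1}(split_pair_merge ji cj) weight_split_pair //.
  by rewrite ffunE eqxx.
by rewrite !ffunE (negbTE ji) eqxx cj subrr.
Qed.

Definition opp_pred (chi : freq) i : pred 'I_n := fun j => (j != i) && (chi j == - chi i).

Lemma card_other (chi : freq) i (A : pred 'I_n) : weight chi = m.+2 -> chi i != 0 ->
  (forall j, A j -> (j != i) && (chi j != 0)) -> (#|A| <= m.+1)%N.
Proof.
move=> wm ci hA; rewrite -ltnS -wm /weight [in X in (_ < X)%N](cardD1 i).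
have -> : (i \in [pred l | chi l != 0]) = true by rewrite inE.
rewrite add1n ltnS.
by apply/subset_leq_card/fintype.subsetP => j /hA; rewrite !inE.
Qed.

Lemma opp_predW (chi : freq) i j : chi i != 0 -> opp_pred chi i j -> (j != i) && (chi j != 0).
Proof. by move=> ci /andP[-> /eqP ->]; rewrite oppr_eq0. Qed.

(** The remaining opposite coordinates survive the merging. Summed over the non-zero values v of the
    pair, their number gives the weight m of the merged frequency, whereas a constant 1 would give
    k; this saves a factor of order n. *)
Lemma card_opp (chi : freq) i j : chi i != 0 -> opp_pred chi i j ->
  #|opp_pred chi i|.-1 = mult (merge chi i j) (- chi i).
Proof.
move=> ci hj; have /andP[ji /eqP cj] := hj.
have jo : j \in opp_pred chi i by exact: hj.
rewrite (cardD1 j) jo add1n /=; apply: eq_card => l; rewrite !inE ffunE /opp_pred /in_mem /=.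
have z0 : (0 == - chi i) = false by rewrite eq_sym oppr_eq0 (negbTE ci).
case: (eqVneq l i) => [->|li] /=; first by rewrite andbF z0.
by case: (eqVneq l j) => [->|lj] //=; rewrite cj subrr z0.
Qed.

(* By [fhat_rec], [q f(chi) = - (U + E)] where [U] collects the coordinates [j]
   with [chi j = - chi i] and [E] is of smaller order; cubing and summing over
   [chi] and [i], the diagonal part of [U ^ 3] reproduces [level3 m]. *)
Lemma level_recursion (S1 S0 : R) : (0 < q)%N -> 0 <= S0 -> 0 <= S1 ->
  (forall chi : freq, weight chi = m.+1 -> `|fhat R chi| <= S1) ->
  (forall chi : freq, weight chi = m -> `|fhat R chi| <= S0) ->
  `|q%:R ^+ 3 * m.+2%:R * level3 R k m.+2 + (q.+1 * q)%:R * k%:R * level3 R k m| <=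
  m.+1%:R * S1 * (3 / 2 * (q%:R ^+ 2 * m.+2%:R * level2 R k m.+2 +
        m.+1%:R * ((q.+1 * q)%:R * k%:R * level2 R k m))) +
  m.+2%:R * S0 * ((q.+1 * q)%:R * m%:R * level2 R k m).
Proof.
move=> q_gt0 S00 S10 hS1 hS0.
pose u (chi : freq) i j := fhat R (merge chi i j).
pose U (chi : freq) i := \sum_(j | opp_pred chi i j) u chi i j.
pose V (chi : freq) i := \sum_(j | opp_pred chi i j) u chi i j ^+ 2.
have cardk : \sum_(v : 'I_n | v != 0) 1 = k%:R :> R.
  rewrite sumr_const; congr _%:R.
  have := cardC1 (0 : 'I_n); rewrite card_ord /= => hk; rewrite -[RHS]hk.
  by apply: eq_card => v; rewrite !inE.
have T2 : \sum_(chi : freq | weight chi == m.+2) \sum_(i | chi i != 0) fhat R chi ^+ 3 =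
    m.+2%:R * level3 R k m.+2.
  rewrite mulr_sumr; apply: eq_bigr => chi /eqP wm.
  by rewrite sumr_const mulr_natl -wm; congr (_ *+ _); apply: eq_card => i; rewrite !inE.
have W2 : \sum_(chi : freq | weight chi == m.+2) \sum_(i | chi i != 0) fhat R chi ^+ 2 =
    m.+2%:R * level2 R k m.+2.
  rewrite mulr_sumr; apply: eq_bigr => chi /eqP wm.
  by rewrite sumr_const mulr_natl -wm; congr (_ *+ _); apply: eq_card => i; rewrite !inE.
have T0 : \sum_(chi : freq | weight chi == m.+2) \sum_(i | chi i != 0)
     \sum_(j | opp_pred chi i j) u chi i j ^+ 3 = (q.+1 * q)%:R * k%:R * level3 R k m.
  rewrite (sum_opposite_pairs (fun psi _ => fhat R psi ^+ 3) qm) -mulrA; congr (_ * _).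
  rewrite mulr_sumr; apply: eq_bigr => psi _; rewrite -cardk mulr_suml.
  by apply: eq_bigr => v _; rewrite mul1r.
have W0 : \sum_(chi : freq | weight chi == m.+2) \sum_(i | chi i != 0) V chi i =
    (q.+1 * q)%:R * k%:R * level2 R k m.
  rewrite (sum_opposite_pairs (fun psi _ => fhat R psi ^+ 2) qm) -mulrA; congr (_ * _).
  rewrite mulr_sumr; apply: eq_bigr => psi _; rewrite -cardk mulr_suml.
  by apply: eq_bigr => v _; rewrite mul1r.
have X0 : \sum_(chi : freq | weight chi == m.+2) \sum_(i | chi i != 0)
     \sum_(j | opp_pred chi i j) u chi i j ^+ 2 * #|opp_pred chi i|.-1%:R =
    (q.+1 * q)%:R * m%:R * level2 R k m.
  transitivity (\sum_(chi : freq | weight chi == m.+2) \sum_(i | chi i != 0)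
     \sum_(j | opp_pred chi i j) (fun psi v => fhat R psi ^+ 2 * (mult psi (- v))%:R) (merge chi i j) (chi i)).
    apply: eq_bigr => chi _; apply: eq_bigr => i ci; apply: eq_bigr => j hj.
    by rewrite (card_opp ci hj).
  rewrite (sum_opposite_pairs (fun psi v => fhat R psi ^+ 2 * (mult psi (- v))%:R) qm) -mulrA; congr (_ * _).
  rewrite mulr_sumr; apply: eq_bigr => psi /eqP wm; rewrite -mulr_sumr mulrC; congr (_ * _).
  rewrite -natr_sum; congr _%:R; rewrite -wm -sum_mult_pos.
  rewrite [RHS](reindex_inj (@oppr_inj 'I_n)) /=; apply: eq_bigl => v.
  by rewrite oppr_eq0.
have pointwise (chi : freq) i : weight chi = m.+2 -> chi i != 0 ->
  `|q%:R ^+ 3 * fhat R chi ^+ 3 + \sum_(j | opp_pred chi i j) u chi i j ^+ 3| <=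
   m.+1%:R * S1 * (3 / 2 * (q%:R ^+ 2 * fhat R chi ^+ 2 + m.+1%:R * V chi i)) +
   m.+2%:R * S0 * \sum_(j | opp_pred chi i j) u chi i j ^+ 2 * #|opp_pred chi i|.-1%:R.
  move=> wm ci.
  have cardopp : (#|opp_pred chi i| <= m.+1)%N.
    by apply: (card_other wm ci) => j; exact: opp_predW.
  have ule j : opp_pred chi i j -> `|u chi i j| <= S0.
    move=> /andP[ji /eqP cj]; apply: hS0; apply/eqP.
    by rewrite -eqSS -eqSS -(weight_merge_opp ji ci cj) wm.
  pose Ap j := [&& j != i, chi j != 0 & chi j != - chi i].
  pose E := \sum_(j | Ap j) u chi i j.
  (* A frequency of weight m + 2 has q - 1 zeros, so the coefficient in [fhat_rec] is q. Cancelling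
     merges lower the weight by two and form U; the others lower it by one and form E. *)
  have hq : q%:R * fhat R chi = - (U chi i + E).
    have <- : (mult chi 0).+1 = q.
      by apply/eqP; rewrite -(eqn_add2r m.+1) qm -(mult0_weight chi) wm addSnnS.
    rewrite (fhat_rec R ci) (bigID (fun j => chi j == - chi i)) /=; congr (- (_ + _)).
      apply: eq_bigl => j; rewrite /opp_pred.
      by case: (eqVneq (chi j) (- chi i)) => [->|_]; rewrite ?andbF // oppr_eq0 ci !andbT.
    by apply: eq_bigl => j; rewrite /Ap andbA.
  have hE : `|E| <= m.+1%:R * S1.
    apply: le_trans (ler_norm_sum _ _ _) _.
    apply: (@le_trans _ _ (\sum_(j | Ap j) S1)).
      apply: ler_sum => j /and3P[ji cj cij]; apply: hS1; apply/eqP.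
      rewrite -eqSS -(weight_merge ji ci cj) ?wm //.
      by rewrite addrC addr_eq0.
    rewrite sumr_const -[leLHS]mulr_natl ler_wpM2r // ler_nat.
    by apply: (card_other wm ci) => j /and3P[-> ->].
  have hU : `|U chi i| <= m.+1%:R * S0.
    apply: le_trans (ler_norm_sum _ _ _) _.
    apply: (@le_trans _ _ (\sum_(j | opp_pred chi i j) S0)); first exact: ler_sum.
    by rewrite sumr_const -[leLHS]mulr_natl ler_wpM2r // ler_nat.
  have h1 := cube_perturb hq hE.
  have h2 := @cube_sum_diff_le _ (opp_pred chi i) (u chi i) (m.+2%:R * S0) _.
  have -> : q%:R ^+ 3 * fhat R chi ^+ 3 + \sum_(j | opp_pred chi i j) u chi i j ^+ 3 =
     ((q%:R * fhat R chi) ^+ 3 + U chi i ^+ 3) - (U chi i ^+ 3 - \sum_(j | opp_pred chi i j) u chi i j ^+ 3).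
    have gen (a b c : R) : a + c = (a + b) - (b - c) by ring.
    by rewrite [(q%:R * _) ^+ 3]exprMn; exact: gen.
  apply: le_trans (ler_normB _ _) _; apply: lerD.
    apply: le_trans h1 _; apply: ler_wpM2l; first by rewrite mulr_ge0.
    apply: ler_wpM2l; first by lra.
    by rewrite [(q%:R * _) ^+ 2]exprMn lerD2l sqr_sum_le.
  apply: h2 => j hj; apply: le_trans (ler_normD _ _) _.
  by rewrite -[m.+2%:R]natr1 mulrDl mul1r lerD // ule.
have -> : q%:R ^+ 3 * m.+2%:R * level3 R k m.+2 + (q.+1 * q)%:R * k%:R * level3 R k m =
  \sum_(chi : freq | weight chi == m.+2) \sum_(i | chi i != 0)
    (q%:R ^+ 3 * fhat R chi ^+ 3 + \sum_(j | opp_pred chi i j) u chi i j ^+ 3).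
  rewrite -T0 -mulrA -T2 mulr_sumr -big_split /=; apply: eq_bigr => chi _.
  by rewrite big_split /= mulr_sumr.
apply: (@le_trans _ _ (\sum_(chi : freq | weight chi == m.+2) \sum_(i | chi i != 0)
   (m.+1%:R * S1 * (3 / 2 * (q%:R ^+ 2 * fhat R chi ^+ 2 + m.+1%:R * V chi i)) +
   m.+2%:R * S0 * \sum_(j | opp_pred chi i j) u chi i j ^+ 2 * #|opp_pred chi i|.-1%:R))).
  apply: le_trans (ler_norm_sum _ _ _) _; apply: ler_sum => chi /eqP wm.
  apply: le_trans (ler_norm_sum _ _ _) _; apply: ler_sum => i ci.
  exact: pointwise.
rewrite le_eqVlt; apply/orP; left; apply/eqP.
rewrite -X0 -W0 -[q%:R ^+ 2 * _ * _]mulrA -W2.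
have lin (a b c d g : R) (f1 f2 f3 : freq -> 'I_n -> R) :
  \sum_(chi : freq | weight chi == m.+2) \sum_(i | chi i != 0)
    (a * (b * (c * f1 chi i + d * f2 chi i)) + g * f3 chi i) =
  a * (b * (c * \sum_(chi : freq | weight chi == m.+2) \sum_(i | chi i != 0) f1 chi i +
    d * \sum_(chi : freq | weight chi == m.+2) \sum_(i | chi i != 0) f2 chi i)) +
    g * \sum_(chi : freq | weight chi == m.+2) \sum_(i | chi i != 0) f3 chi i.
  rewrite !mulr_sumr -big_split /= !mulr_sumr -big_split /=; apply: eq_bigr => chi _.
  by rewrite !mulr_sumr -big_split /= !mulr_sumr -big_split.
exact: (lin _ _ _ _ _ (fun chi _ => fhat R chi ^+ 2) V
  (fun chi i => \sum_(j | opp_pred chi i j) u chi i j ^+ 2 * #|opp_pred chi i|.-1%:R)).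
Qed.

End Step.
End RecursionBound.

(** * Initial levels and the recursion with error O(n^(-1/2)) *)

Section LevelLimit.
Variables (R : realType).

Lemma level3_0 k : level3 R k 0 = 1.
Proof.
rewrite /level3 (big_pred1 [ffun=> 0]) => [|chi]; last first.
  apply/idP/eqP => [/eqP/card0_eq h|->]; last first.
    by apply/eqP/eq_card0 => i; rewrite inE ffunE eqxx.
  by apply/ffunP => i; have := h i; rewrite inE ffunE => /negbFE/eqP.
have -> : fhat R [ffun=> 0 : 'I_k.+1] = 1; last by rewrite expr1n.
apply: (mulfI (factR_neq0 R k.+1)); apply: (@complexI R).
rewrite -charsumE mulr1 rmorph_nat /charsum (eq_bigr (fun=> 1)) => [|sigma _].
  by rewrite sumr_const card_Sn.
by rewrite big1 // => i _; rewrite ffunE echar0.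
Qed.

(** With a single non-zero entry the sum in [fhat_rec] is empty. *)
Lemma level3_1 k : level3 R k 1 = 0.
Proof.
rewrite /level3 big1 // => chi /eqP w1.
have : (0 < weight chi)%N by rewrite w1.
rewrite /weight => /card_gt0P[l]; rewrite inE => ci.
have := fhat_rec R ci; rewrite big_pred0 => [|j].
  by move/eqP; rewrite oppr0 mulf_eq0 pnatr_eq0 /= => /eqP ->; rewrite expr0n.
apply: contraTF isT => /andP[ji cj].
have : (1 < weight chi)%N; last by rewrite w1.
by rewrite /weight; apply/card_gt1P; exists l, j; split; rewrite ?inE // eq_sym.
Qed.

Lemma level3_le k m (S0 : R) :
  (forall chi : {ffun 'I_k.+1 -> 'I_k.+1}, weight chi = m -> `|fhat R chi| <= S0) ->
  `|level3 R k m| <= S0 * level2 R k m.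
Proof.
move=> h; apply: le_trans (ler_norm_sum _ _ _) _; rewrite mulr_sumr.
apply: ler_sum => chi /eqP wm; rewrite normrX exprS real_normK ?num_real //.
by rewrite ler_wpM2r ?sqr_ge0 // h.
Qed.

(** By the crude bounds, |f| on level j is O(n^(-j/2)) and [level2] is O(n^(j/2)), so all errors in
    [level_recursion] are O(n^(5/2)) against the main coefficient q^3. The last summand of [D] pays
    for replacing (q + 1) q k by q^3. *)
Lemma level3_step m : exists D : R, forall k, (2 * m.+2 <= k.+1)%N ->
  `|m.+2%:R * level3 R k m.+2 + level3 R k m| <= D / Num.sqrt k.+1%:R.
Proof.
pose A1 := (2 * expR (1 / 2) * Num.sqrt m.+1%:R) ^+ m.+1 : R.
pose A0 := (2 * expR (1 / 2) * Num.sqrt m%:R) ^+ m : R.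
pose B2 := expR (1 / 2) * 2 ^+ m.+2 : R.
pose B0 := expR (1 / 2) * 2 ^+ m : R.
pose D := 3 * m.+1%:R * m.+2%:R * (A1 * B2) + 6 * m.+1%:R * m.+1%:R * (A1 * B0)
   + 4 * m.+2%:R * m%:R * (A0 * B0) + 2 * (2 * m%:R + 1) * (A0 * B0).
exists D => k mk.
pose q := (k - m)%N; have qm : (q + m.+1 = k.+1)%N by rewrite /q; lia.
have q_gt0 : (0 < q)%N by rewrite /q; lia.
have e1 : (q + m = k)%N by rewrite /q; lia.
have mq_nat : (m <= q)%N by rewrite /q; lia.
have n2q_nat : (k.+1 <= 2 * q)%N by rewrite /q; lia.
have m1 : (2 * m.+1 <= k.+1)%N by lia.
have m0 : (2 * m <= k.+1)%N by lia.
have qR : 0 < q%:R :> R by rewrite ltr0n.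
set s : R := Num.sqrt k.+1%:R.
have s0 : 0 < s by exact: sqn_gt0.
have s1 : 1 <= s by rewrite /s -[X in X <= _]sqrtr1 ler_sqrt ?ler0n // ler1n.
have s2 : s ^+ 2 = k.+1%:R by exact: sqn2.
have n2q : k.+1%:R <= 2 * q%:R :> R by rewrite -natrM ler_nat.
have A10 : 0 <= A1 by rewrite /A1; nneg.
have A00 : 0 <= A0 by rewrite /A0; nneg.
have B20 : 0 <= B2 by rewrite /B2; nneg.
have B00 : 0 <= B0 by rewrite /B0; nneg.
have sm0 j : 0 < s ^+ j by rewrite exprn_gt0.
have hS1 (chi : {ffun 'I_k.+1 -> 'I_k.+1}) : weight chi = m.+1 -> `|fhat R chi| <= A1 / s ^+ m.+1.
  move=> w; apply: le_trans (fhat_crude _ m1 w) _.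
  by rewrite expr_div_n.
have hS0 (chi : {ffun 'I_k.+1 -> 'I_k.+1}) : weight chi = m -> `|fhat R chi| <= A0 / s ^+ m.
  move=> w; apply: le_trans (fhat_crude _ m0 w) _.
  by rewrite expr_div_n.
have hW2 : level2 R k m.+2 <= B2 * s ^+ m.+2.
  by apply: le_trans (level2_crude R k m.+2) _; rewrite exprMn mulrA.
have hW0 : level2 R k m <= B0 * s ^+ m.
  by apply: le_trans (level2_crude R k m) _; rewrite exprMn mulrA.
have S10 : 0 <= A1 / s ^+ m.+1 by rewrite divr_ge0 // ltW.
have S00 : 0 <= A0 / s ^+ m by rewrite divr_ge0 // ltW.
have rec := level_recursion qm q_gt0 S00 S10 hS1 hS0.
have p1 : A1 / s ^+ m.+1 * level2 R k m.+2 <= A1 * B2 * s.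
  apply: le_trans (ler_wpM2l S10 hW2) _.
  rewrite le_eqVlt; apply/orP; left; apply/eqP.
  by rewrite (exprS s m.+1); field; rewrite gt_eqF.
have p2 : A1 / s ^+ m.+1 * level2 R k m <= A1 * B0 / s.
  apply: le_trans (ler_wpM2l S10 hW0) _.
  rewrite le_eqVlt; apply/orP; left; apply/eqP.
  by rewrite (exprS s m); field; rewrite !gt_eqF.
have p3 : A0 / s ^+ m * level2 R k m <= A0 * B0.
  apply: le_trans (ler_wpM2l S00 hW0) _.
  rewrite le_eqVlt; apply/orP; left; apply/eqP.
  by field; rewrite gt_eqF.
have hT0 : `|level3 R k m| <= A0 * B0 by apply: le_trans (level3_le hS0) p3.
have kq : k%:R = q%:R + m%:R :> R.
  by rewrite -[in LHS]e1; exact: natrD.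
have q1 : q.+1%:R = q%:R + 1 :> R by rewrite natr1.
have mq : m%:R <= q%:R :> R by rewrite ler_nat.
have q1' : 1 <= q%:R :> R by rewrite ler1n.
have inv : 1 <= 2 * q%:R / s.
  rewrite ler_pdivlMr // mul1r; apply: le_trans n2q.
  by rewrite -s2 -[leLHS]mulr1 expr2 ler_pM2l.
have inv2 : s <= 2 * q%:R / s by rewrite ler_pdivlMr // -expr2 s2.
have q3 : 0 < q%:R ^+ 3 :> R by rewrite exprn_gt0.
have main : q%:R ^+ 3 * `|m.+2%:R * level3 R k m.+2 + level3 R k m| <= q%:R ^+ 3 * (D / s).
  rewrite -[X in X * `|_|](ger0_norm (ltW q3)) -normrM mulrDr [q%:R ^+ 3 * (m.+2%:R * _)]mulrA.
  have -> : q%:R ^+ 3 * m.+2%:R * level3 R k m.+2 + q%:R ^+ 3 * level3 R k m =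
    (q%:R ^+ 3 * m.+2%:R * level3 R k m.+2 + (q.+1 * q)%:R * k%:R * level3 R k m) -
    (q%:R * ((m%:R + 1) * q%:R + m%:R)) * level3 R k m.
    by rewrite natrM q1 kq; ring.
  apply: le_trans (ler_normB _ _) _.
  have r4 : `|q%:R * ((m%:R + 1) * q%:R + m%:R) * level3 R k m| <=
      q%:R ^+ 3 * (2 * (2 * m%:R + 1) * (A0 * B0) / s).
    rewrite normrM ger0_norm; last by nneg.
    apply: (@le_trans _ _ (q%:R * ((m%:R + 1) * q%:R + m%:R * q%:R) * (A0 * B0))).
      apply: ler_pM => //.
      apply: ler_wpM2l => //; rewrite lerD2l -[leLHS]mulr1; exact: ler_wpM2l.
    have -> : q%:R ^+ 3 * (2 * (2 * m%:R + 1) * (A0 * B0) / s) =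
       (q%:R * ((m%:R + 1) * q%:R + m%:R * q%:R) * (A0 * B0)) * (2 * q%:R / s) by ring.
    by rewrite -[leLHS]mulr1; apply: ler_wpM2l => //; nneg.
  have r1 : m.+1%:R * (A1 / s ^+ m.+1) * (3 / 2 * (q%:R ^+ 2 * m.+2%:R * level2 R k m.+2)) <=
      q%:R ^+ 3 * (3 * m.+1%:R * m.+2%:R * (A1 * B2) / s).
    have -> : m.+1%:R * (A1 / s ^+ m.+1) * (3 / 2 * (q%:R ^+ 2 * m.+2%:R * level2 R k m.+2)) =
       (3 / 2 * m.+1%:R * m.+2%:R * q%:R ^+ 2) * (A1 / s ^+ m.+1 * level2 R k m.+2) by ring.
    have -> : q%:R ^+ 3 * (3 * m.+1%:R * m.+2%:R * (A1 * B2) / s) =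
       (3 / 2 * m.+1%:R * m.+2%:R * q%:R ^+ 2) * (A1 * B2 * (2 * q%:R / s)) by field; rewrite gt_eqF.
    apply: ler_wpM2l; first by nneg.
    apply: le_trans p1 _; apply: ler_wpM2l => //; nneg.
  have qk : (q.+1 * q)%:R * k%:R <= 4 * q%:R ^+ 3 :> R.
    rewrite natrM q1 kq; have -> : 4 * q%:R ^+ 3 = (q%:R + q%:R) * q%:R * (q%:R + q%:R) :> R by ring.
    by apply: ler_pM; nneg; [apply: ler_wpM2r => //; rewrite lerD2l|rewrite lerD2l].
  have r2 : m.+1%:R * (A1 / s ^+ m.+1) * (3 / 2 * (m.+1%:R * ((q.+1 * q)%:R * k%:R * level2 R k m))) <=
      q%:R ^+ 3 * (6 * m.+1%:R * m.+1%:R * (A1 * B0) / s).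
    have -> : m.+1%:R * (A1 / s ^+ m.+1) * (3 / 2 * (m.+1%:R * ((q.+1 * q)%:R * k%:R * level2 R k m))) =
       (3 / 2 * m.+1%:R * m.+1%:R) * (((q.+1 * q)%:R * k%:R) * (A1 / s ^+ m.+1 * level2 R k m)) by ring.
    have -> : q%:R ^+ 3 * (6 * m.+1%:R * m.+1%:R * (A1 * B0) / s) =
       (3 / 2 * m.+1%:R * m.+1%:R) * ((4 * q%:R ^+ 3) * (A1 * B0 / s)) by field; rewrite gt_eqF.
    apply: ler_wpM2l; first by nneg.
    by apply: ler_pM => //; nneg; exact: level2_ge0.
  have r3 : m.+2%:R * (A0 / s ^+ m) * ((q.+1 * q)%:R * m%:R * level2 R k m) <=
      q%:R ^+ 3 * (4 * m.+2%:R * m%:R * (A0 * B0) / s).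
    have -> : m.+2%:R * (A0 / s ^+ m) * ((q.+1 * q)%:R * m%:R * level2 R k m) =
       (m.+2%:R * m%:R) * ((q.+1 * q)%:R * (A0 / s ^+ m * level2 R k m)) by ring.
    have -> : q%:R ^+ 3 * (4 * m.+2%:R * m%:R * (A0 * B0) / s) =
       (m.+2%:R * m%:R) * ((2 * q%:R ^+ 2) * (A0 * B0 * (2 * q%:R / s))) by field; rewrite gt_eqF.
    apply: ler_wpM2l; first by nneg.
    apply: ler_pM; nneg; first exact: level2_ge0.
      rewrite natrM q1; have -> : 2 * q%:R ^+ 2 = (q%:R + q%:R) * q%:R :> R by ring.
      by apply: ler_wpM2r => //; rewrite lerD2l.
    by apply: le_trans p3 _; rewrite -[leLHS]mulr1; apply: ler_wpM2l => //; nneg.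
  have -> : q%:R ^+ 3 * (D / s) = (q%:R ^+ 3 * (3 * m.+1%:R * m.+2%:R * (A1 * B2) / s) +
      q%:R ^+ 3 * (6 * m.+1%:R * m.+1%:R * (A1 * B0) / s) +
      q%:R ^+ 3 * (4 * m.+2%:R * m%:R * (A0 * B0) / s)) +
      q%:R ^+ 3 * (2 * (2 * m%:R + 1) * (A0 * B0) / s).
    by rewrite /D; move: A1 A0 B2 B0 {A10 A00 B20 B00 hS1 hS0 hW2 hW0 S10 S00 rec p1 p2 p3 hT0 r1 r2 r3 r4 D} => A1 A0 B2 B0; ring.
  apply: lerD r4; apply: le_trans rec _.
  by rewrite mulrDr mulrDr; apply: lerD r3; apply: lerD.
by move: main; rewrite ler_pM2l.
Qed.

End LevelLimit.

(** * Limits of the levels and summation by dominated convergence *)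

Section SparseLimit.
Local Open Scope classical_set_scope.
Local Open Scope ring_scope.
Variable R : realType.

(** The power series coefficients of exp(-x^2/2), given by their two-step recursion. *)
Fixpoint ell (m : nat) : R :=
  match m with 0 => 1 | 1 => 0 | (m'.+1 as m1).+1 => - ell m' / m1.+1%:R end.

Lemma cvg_inv_sqrt (D : R) : D / Num.sqrt k.+1%:R @[k --> \oo] --> (0 : R).
Proof.
rewrite -(mulr0 D); apply: cvgM; first exact: cvg_cst.
have -> : (fun k => (Num.sqrt k.+1%:R)^-1 : R) = (fun k => Num.sqrt (harmonic k)).
  by apply/funext => k; rewrite /harmonic /= sqrtrV.
rewrite -sqrtr0; apply: continuous_cvg; last exact: cvg_harmonic.
exact: sqrt_continuous.
Qed.

Lemma level3_cvg m : level3 R k m @[k --> \oo] --> ell m.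
Proof.
have : (level3 R k m @[k --> \oo] --> ell m) /\ (level3 R k m.+1 @[k --> \oo] --> ell m.+1).
  elim: m => [|m [IH1 IH2]]; last first.
    split=> //; have [D hD] := level3_step R m.
    have h0 : m.+2%:R * level3 R k m.+2 + level3 R k m @[k --> \oo] --> (0 : R).
      apply: (@squeeze_cvgr _ _ _ _ (fun k => - (D / Num.sqrt k.+1%:R)) (fun k => D / Num.sqrt k.+1%:R)).
      - near=> k; rewrite -ler_norml; apply: hD; near: k; exists (2 * m.+2)%N => //= k /=.
        by move=> h; apply: leq_trans h _.
      - by rewrite -oppr0; apply: cvgN; exact: cvg_inv_sqrt.
      - exact: cvg_inv_sqrt.
    have -> : (fun k => level3 R k m.+2) =
        (fun k => ((m.+2%:R * level3 R k m.+2 + level3 R k m) - level3 R k m) / m.+2%:R).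
      by apply/funext => k; rewrite addrK mulrAC divff ?mul1r // pnatr_eq0.
    have -> : ell m.+2 = (0 - ell m) / m.+2%:R by rewrite sub0r.
    by apply: cvgM; [exact: cvgB|exact: cvg_cst].
  split.
    have -> : (fun k => level3 R k 0) = (fun=> 1) by apply/funext => k; exact: level3_0.
    exact: cvg_cst.
  have -> : (fun k => level3 R k 1) = (fun=> 0) by apply/funext => k; exact: level3_1.
  exact: cvg_cst.
by case.
Unshelve. all: by end_near.
Qed.

Lemma level3_sum_cvg N : \sum_(m < N) level3 R k m @[k --> \oo] --> \sum_(m < N) ell m.
Proof.
elim: N => [|N IH].
  have -> : (fun k => \sum_(m < 0) level3 R k m) = (fun=> 0).
    by apply/funext => k; rewrite big_ord0.
  by rewrite big_ord0; exact: cvg_cst.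
have -> : (fun k => \sum_(m < N.+1) level3 R k m) =
    (fun k => \sum_(m < N) level3 R k m + level3 R k N).
  by apply/funext => k; rewrite big_ord_recr.
by rewrite big_ord_recr; apply: cvgD => //; exact: level3_cvg.
Qed.

Lemma ell_even j : ell j.*2 = exp_coeff (- (1 / 2)) j /\ ell j.*2.+1 = 0.
Proof.
elim: j => [|j [IH1 IH2]]; first by rewrite /exp_coeff /= expr0 fact0 divr1.
split; last first.
  by rewrite doubleS [LHS]/= -/(ell j.*2.+1) IH2 oppr0 mul0r.
rewrite doubleS [LHS]/= -/(ell j.*2) IH1 /exp_coeff /= factS natrM exprS.
have -> : j.*2.+2%:R = 2 * j.+1%:R :> R by rewrite -natrM mul2n doubleS.
by field; rewrite factR_neq0 nat1r pnatr_eq0.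
Qed.

Lemma sum_ell J : \sum_(m < J.*2) ell m = series (exp_coeff (- (1 / 2))) J.
Proof.
elim: J => [|J IH]; first by rewrite big_ord0 /series /= big_geq.
have [h1 h2] := ell_even J.
rewrite -(big_mkord xpredT ell) doubleS big_nat_recr // big_nat_recr //.
by rewrite h1 h2 big_mkord IH /= addr0 /series /= big_nat_recr.
Qed.

Lemma geometric_tail_le (B t : R) (N M : nat) : 0 <= B -> 0 <= t < 1 ->
  \sum_(N <= m < M) B * t ^+ m <= B * t ^+ N / (1 - t).
Proof.
move=> B0 /andP[t0 t1]; have d : 0 < 1 - t by rewrite subr_gt0.
have [MN|NM] := leqP M N.
  by rewrite big_geq // divr_ge0 ?(ltW d) // mulr_ge0 ?exprn_ge0.
rewrite -mulr_sumr -mulrA ler_wpM2l // -{1}(add0n N) big_addn big_mkord.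
under eq_bigr => j _ do rewrite exprD mulrC.
rewrite -mulr_sumr ler_wpM2l ?exprn_ge0 //.
rewrite -[leRHS]mul1r ler_pdivlMr // mulrC -[1 - _]opprB mulNr -subrX1 opprB.
by rewrite lerBlDr lerDl exprn_ge0.
Qed.

Lemma geometric_small (B t eps : R) : 0 <= t < 1 -> 0 < eps ->
  exists N0, forall N, (N0 <= N)%N -> B * t ^+ N / (1 - t) <= eps.
Proof.
move=> /andP[t0 t1] e0.
have h : B * t ^+ N / (1 - t) @[N --> \oo] --> (0 : R).
  have -> : (fun N => B * t ^+ N / (1 - t)) = (fun N => (B / (1 - t)) * t ^+ N).
    by apply/funext => N; rewrite mulrAC.
  rewrite -(mulr0 (B / (1 - t))); apply: cvgM; first exact: cvg_cst.
  by apply: cvg_expr; rewrite ger0_norm.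
have /cvgrPdist_le/(_ _ e0)[N0 _ hN0] := h.
exists N0 => N hN; have := hN0 N hN; rewrite sub0r normrN.
exact: le_trans (ler_norm _).
Qed.

Lemma sparse_sum_limit (eps : R) : 0 < eps -> exists K, forall k M, (K <= k)%N ->
  M%:R <= eta R ^+ 4 * k.+1%:R -> eta R ^+ 4 * k.+1%:R < M.+1%:R ->
  `|\sum_(m < M.+1) level3 R k m - expR (- (1 / 2))| <= eps.
Proof.
move=> e0; have e3 : 0 < eps / 3 by rewrite divr_gt0.
have t01 : 0 <= (19 / 20 : R) < 1 by lra.
have [N0 hN0] := geometric_small (domconst R) t01 e3.
have [J0 hJ0] : exists J0, forall J, (J0 <= J)%N ->
    `|series (exp_coeff (- (1 / 2))) J - expR (- (1 / 2))| <= eps / 3.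
  have : series (exp_coeff (- (1 / 2) : R)) J @[J --> \oo] --> expR (- (1 / 2)).
    exact: is_cvg_series_exp_coeff.
  move=> /cvgrPdist_le/(_ _ e3)[J0 _ h]; exists J0 => J hJ.
  by rewrite distrC; exact: h.
(* N is even because two levels make up one term of the exponential series ([sum_ell]); J >= 8 makes
   [level3_dominated] available from N on. *)
pose J := maxn 8 (maxn N0 J0); pose N := J.*2.
have hfin : \sum_(m < N) level3 R k m @[k --> \oo] --> \sum_(m < N) ell m.
  exact: level3_sum_cvg.
have /cvgrPdist_le/(_ _ e3)[K1 _ hK1] := hfin.
have eta0 : 0 < eta R ^+ 4 by rewrite exprn_gt0 // /eta; lra.
have [K2 hK2] : exists K2 : nat, forall k, (K2 <= k)%N -> N%:R <= eta R ^+ 4 * k.+1%:R.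
  exists (Num.truncn (N%:R / eta R ^+ 4)) => k hk.
  rewrite mulrC -ler_pdivrMr // ltW //.
  by apply: lt_le_trans (truncnS_gt _) _; rewrite ler_nat.
exists (maxn K1 K2) => k M; rewrite geq_max => /andP[k1 k2] hM1 hM2.
have NM : (N < M.+1)%N by rewrite -(ltr_nat R); apply: le_lt_trans hM2; exact: hK2.
have J8 : (8 <= J)%N by rewrite leq_max leqnn.
have JN : (J <= N)%N by rewrite /N -addnn leq_addr.
rewrite -(big_mkord xpredT (fun m => level3 R k m)) (@big_cat_nat _ _ _ N) //=; last exact: ltnW.
have b1 : `|\sum_(0 <= m < N) level3 R k m - \sum_(m < N) ell m| <= eps / 3.
  by rewrite distrC big_mkord; exact: hK1.
have b2 : `|\sum_(m < N) ell m - expR (- (1 / 2))| <= eps / 3.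
  by rewrite sum_ell; apply: hJ0; rewrite !leq_max leqnn !orbT.
have b3 : `|\sum_(N <= m < M.+1) level3 R k m| <= eps / 3.
  apply: le_trans (ler_norm_sum _ _ _) _.
  have dom0 : 0 <= domconst R by rewrite /domconst; nneg.
  apply: le_trans (hN0 N _); last by apply: leq_trans JN; rewrite !leq_max leqnn !orbT.
  apply: le_trans (geometric_tail_le N M.+1 dom0 t01).
  rewrite big_nat_cond [leRHS]big_nat_cond; apply: ler_sum => m; rewrite andbT => /andP[h1 h2].
  apply: level3_dominated; first by apply: leq_trans J8 (leq_trans JN h1).
  by apply: le_trans hM1; rewrite ler_nat.
set a := \sum_(0 <= m < N) _ in b1 *; set b := \sum_(m < N) ell m in b1 b2.
set c := \sum_(N <= m < M.+1) _ in b3 *.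
have -> : a + c - expR (- (1 / 2)) = (a - b) + (b - expR (- (1 / 2))) + c by ring.
apply: le_trans (ler_normD _ _) _.
have := ler_normD (a - b) (b - expR (- (1 / 2))).
by move: b1 b2 b3; lra.
Qed.

End SparseLimit.

(** * Frequencies without a majority value, and the conclusion *)

Section MajorityDecomposition.
Variables (R : realType) (k M : nat).
Local Notation n := k.+1.
Local Notation freq := {ffun 'I_n -> 'I_n}.
Hypothesis even_k : ~~ odd k.
Hypothesis M2n : (2 * M < n)%N.

(** Two such values would together take at least 2 (n - M) > n entries. *)
Lemma majority_unique (chi : freq) c d :
  (n - M.+1 < mult chi c)%N -> (n - M.+1 < mult chi d)%N -> c = d.
Proof.
move=> hc hd; apply/eqP; apply: contraT => cd.
have := sum_mult chi; rewrite (bigD1 c) // (bigD1 d) /=; last by rewrite eq_sym.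
set x := mult chi c in hc *; set y := mult chi d in hd *.
by move: (\sum_(i | _) _)%N => z; lia.
Qed.

Lemma majority_shift c :
  \sum_(chi : freq | (n - M.+1 < mult chi c)%N) fhat R chi ^+ 3 =
  \sum_(chi : freq | (n - M.+1 < mult chi 0%R)%N) fhat R chi ^+ 3.
Proof.
have inj : injective (fun chi : freq => [ffun i => chi i + c]).
  move=> x y /ffunP h; apply/ffunP => i; have := h i; rewrite !ffunE.
  exact: addIr.
rewrite (reindex_inj inj) /=; apply: eq_big => [chi|chi _]; last by rewrite fhat_shift.
congr (_ < _)%N; apply: eq_card => i; rewrite !inE ffunE.
by rewrite -{2}[c]add0r (inj_eq (addIr c)).
Qed.

Lemma majority_levels :
  \sum_(chi : freq | (n - M.+1 < mult chi 0%R)%N) fhat R chi ^+ 3 =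
  \sum_(m < M.+1) level3 R k m.
Proof.
(* Since M < n the truncated subtraction is exact: more than n - (M + 1) zeros means weight at most
   M. *)
have hw (chi : freq) : (n - M.+1 < mult chi 0%R)%N = (weight chi < M.+1)%N.
  have := mult0_weight chi; move: (mult chi _) (weight chi) => x y.
  by move: M2n => h1 h2; apply/idP/idP; lia.
rewrite (eq_bigl _ _ hw).
rewrite (partition_big (fun chi : freq => inord (weight chi) : 'I_M.+1) xpredT) //=.
apply: eq_bigr => m _; apply: eq_bigl => chi.
apply/andP/eqP => [[h1 /eqP <-]|->]; first by rewrite inordK.
by rewrite inord_val eqxx.
Qed.

Lemma majority_decomposition :
  \sum_(chi : freq) fhat R chi ^+ 3 =
  \sum_(chi : freq | [forall c, (mult chi c <= n - M.+1)%N]) fhat R chi ^+ 3 +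
  n%:R * \sum_(m < M.+1) level3 R k m.
Proof.
rewrite (bigID (fun chi : freq => [forall c, (mult chi c <= n - M.+1)%N])) /=.
congr (_ + _).
transitivity (\sum_(c : 'I_n) \sum_(chi : freq | (n - M.+1 < mult chi c)%N) fhat R chi ^+ 3).
  rewrite (exchange_big_dep (fun chi : freq => ~~ [forall c, (mult chi c <= n - M.+1)%N])) /=.
    apply: eq_bigr => chi; rewrite negb_forall => /existsP[c]; rewrite -ltnNge => hc.
    rewrite (big_pred1 c) // => d; apply/idP/eqP => [hd|-> //].
    exact: majority_unique hd hc.
  by move=> c chi _ hc; rewrite negb_forall; apply/existsP; exists c; rewrite -ltnNge.
rewrite (eq_bigr _ (fun c _ => majority_shift c)) sumr_const card_ord majority_levels.
by rewrite mulr_natl.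
Qed.

End MajorityDecomposition.

(** * Boundedness of the sum over frequencies without a majority value *)

Section SpreadBound.
Variable R : realType.

(** With r = sqrt t = e^(-a), one factor r^m absorbs m^2, because (m a)^2 <= 2 e^(m a). *)
Lemma sqr_geometric_le (t : R) : 0 < t < 1 ->
  exists C, exists r, [/\ 0 <= C, 0 < r < 1 & forall m : nat, m%:R ^+ 2 * t ^+ m <= C * r ^+ m].
Proof.
move=> /andP[t0 t1]; pose r := Num.sqrt t.
have r0 : 0 < r by rewrite sqrtr_gt0.
have r1 : r < 1 by rewrite -[X in _ < X]sqrtr1 ltr_sqrt.
pose a := - ln r; have a0 : 0 < a by rewrite /a oppr_gt0 ln_lt0 // r0.
have rE : r = expR (- a) by rewrite /a opprK lnK.
exists (2 / a ^+ 2), r; split; [by rewrite divr_ge0 ?sqr_ge0|by rewrite r0|move=> m].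
have tE : t ^+ m = r ^+ m * r ^+ m by rewrite -exprMn -expr2 sqr_sqrtr // ltW.
rewrite tE mulrA ler_wpM2r ?exprn_ge0 ?(ltW r0) //.
have := @pow_le_fact_exp R (m%:R * a) 2 (mulr_ge0 (ler0n _ _) (ltW a0)).
rewrite exprMn => h; rewrite ler_pdivlMr ?exprn_gt0 //.
have -> : r ^+ m = (expR (m%:R * a))^-1 by rewrite rE -expRM_natl mulrN expRN.
rewrite mulrAC ler_pdivrMr ?expR_gt0 //.
Qed.

End SpreadBound.

Section SpreadNegligible.
Variable R : realType.
Local Notation e := (expR (1 : R)).

Lemma sqrt_nat_large (Z : R) : exists K, forall k, (K <= k)%N -> Z <= Num.sqrt k.+1%:R.
Proof.
exists (Num.truncn (Z ^+ 2)) => k hk.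
apply: le_trans (ler_norm Z) _; rewrite -sqrtr_sqr ler_sqrt ?ler0n //.
by apply: ltW; apply: lt_le_trans (truncnS_gt _) _; rewrite ler_nat ltnS.
Qed.

Lemma spread_series_le (t : R) : 0 < t < 1 -> exists K, forall k (L : nat), (K <= k)%N ->
  L%:R <= t ^+ 4 * k.+1%:R ->
  \sum_(r < k.+2 | (r <= L)%N) bfac R r * (e ^+ 2 / (t * Num.sqrt k.+1%:R)) ^+ r <= t^-1.
Proof.
move=> t01; have [C [r0 [C0 r01 hC]]] := sqr_geometric_le t01.
have /andP[t0 t1] := t01; have /andP[rho0 rho1] := r01.
pose sg := Num.sqrt r0.
have sg0 : 0 < sg by rewrite sqrtr_gt0.
have sg1 : sg < 1 by rewrite -[X in _ < X]sqrtr1 ltr_sqrt.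
have sg2 : sg ^+ 2 = r0 by rewrite sqr_sqrtr // ltW.
have e0 := expR_gt0 (1 : R).
pose B := e ^+ 2 * C; have B0 : 0 <= B by rewrite /B mulr_ge0 ?sqr_ge0.
pose d := t^-1 - 1; have d0 : 0 < d by rewrite /d subr_gt0 invf_gt1.
have d2 : 0 < d / 2 by rewrite divr_gt0.
have sg01 : 0 <= sg < 1 by rewrite (ltW sg0).
have [N0 hN0] := geometric_small B sg01 d2.
have {hN0} hN := hN0 N0 (leqnn _).
pose A := (e * N0%:R) ^+ 2 / sg ^+ N0.
have A0 : 0 <= A by rewrite /A divr_ge0 ?sqr_ge0 ?exprn_ge0 ?(ltW sg0).
have os : 0 < 1 - sg by rewrite subr_gt0.
(* Small r contribute at most A z/(1 - sg), which is at most d/2 once z <= z0; A + 1 avoids dividing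
   by A = 0. [Z] is chosen so that sqrt n >= Z gives both z <= 1 and z <= z0. *)
pose z0 := d / 2 * (1 - sg) / (A + 1).
have z0p : 0 < z0 by rewrite /z0 divr_gt0 ?mulr_gt0 // ltr_wpDl.
pose Z := Num.sqrt N0%:R / t + Num.sqrt N0%:R / t / z0.
have [K hK] := sqrt_nat_large Z.
exists K => k L kK hL; set s := Num.sqrt k.+1%:R.
have s0 : 0 < s by exact: sqn_gt0.
have sZ : Z <= s := hK k kK.
pose z := Num.sqrt N0%:R / (t * s).
have q0 : 0 <= Num.sqrt N0%:R / t by rewrite divr_ge0 ?sqrtr_ge0 ?(ltW t0).
have zE : z = Num.sqrt N0%:R / t / s by rewrite /z invfM mulrA.
have zge0 : 0 <= z by rewrite zE divr_ge0 // ltW.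
have z1 : z <= 1.
  rewrite zE ler_pdivrMr // mul1r; apply: le_trans sZ.
  by rewrite /Z lerDl divr_ge0 // ltW.
have zz0 : z <= z0.
  rewrite zE ler_pdivrMr // [leRHS]mulrC -ler_pdivrMr //; apply: le_trans sZ.
  by rewrite /Z lerDr.
set y := e ^+ 2 / (t * s).
have y0 : 0 < y by rewrite divr_gt0 ?exprn_gt0 ?mulr_gt0.
have term r : (0 < r)%N -> (r <= L)%N ->
    bfac R r * y ^+ r <= (A * z + B * sg ^+ N0) * sg ^+ r.
  move=> r_gt0 rL.
  have h1 : bfac R r * y ^+ r <= (e * r%:R) ^+ 2 * (Num.sqrt r%:R / (t * s)) ^+ r.
    apply: le_trans (ler_wpM2r _ (bfac_exp R r_gt0)) _; first by rewrite exprn_ge0 // ltW.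
    rewrite -mulrA -exprMn le_eqVlt; apply/orP; left; apply/eqP; congr (_ * _ ^+ _).
    by rewrite /y; field; rewrite !gt_eqF.
  apply: le_trans h1 _; have b0 : 0 <= Num.sqrt r%:R / (t * s).
    by rewrite divr_ge0 ?sqrtr_ge0 // mulr_ge0 // ltW.
  have [rN|Nr] := ltnP r N0.
    apply: (@le_trans _ _ (A * z * sg ^+ r)); last first.
      by rewrite ler_wpM2r ?exprn_ge0 ?(ltW sg0) // lerDl mulr_ge0 ?exprn_ge0 ?(ltW sg0).
    have -> : A * z * sg ^+ r = (e * N0%:R) ^+ 2 * (z * (sg ^+ r / sg ^+ N0)).
      by rewrite /A; ring.
    apply: ler_pM; rewrite ?exprn_ge0 ?sqr_ge0 //.
      apply: lerXn2r; rewrite ?nnegrE ?mulr_ge0 ?(ltW e0) //.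
      by rewrite ler_wpM2l ?(ltW e0) // ler_nat ltnW.
    apply: (@le_trans _ _ z).
      apply: (@le_trans _ _ (z ^+ r)).
        apply: lerXn2r; rewrite ?nnegrE // /z ler_wpM2r ?invr_ge0 ?mulr_ge0 ?(ltW t0) ?(ltW s0) //.
        by rewrite ler_sqrt ?ler0n // ler_nat ltnW.
      by rewrite -[leRHS]expr1; apply: ler_wiXn2l.
    rewrite -[leLHS]mulr1; apply: ler_wpM2l => //.
    rewrite ler_pdivlMr ?exprn_gt0 // mul1r; apply: ler_wiXn2l; rewrite ?(ltW sg0) ?(ltW sg1) //.
    exact: ltnW.
  apply: (@le_trans _ _ (B * sg ^+ N0 * sg ^+ r)); last first.
    by rewrite ler_wpM2r ?exprn_ge0 ?(ltW sg0) // lerDr mulr_ge0.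
  apply: (@le_trans _ _ (e ^+ 2 * (r%:R ^+ 2 * t ^+ r))).
    rewrite exprMn -mulrA; apply: ler_wpM2l; first exact: sqr_ge0.
    apply: ler_wpM2l; first exact: sqr_ge0.
    apply: lerXn2r; rewrite ?nnegrE ?(ltW t0) //.
    rewrite ler_pdivrMr ?mulr_gt0 // mulrA -expr2.
    rewrite -(@ler_pXn2r _ 2) ?nnegrE ?sqrtr_ge0 ?mulr_ge0 ?(ltW t0) ?(ltW s0) //.
    rewrite exprMn sqr_sqrtr ?ler0n // sqn2 -exprM; apply: le_trans hL.
    by rewrite ler_nat.
  have -> : B * sg ^+ N0 * sg ^+ r = e ^+ 2 * (C * (sg ^+ N0 * sg ^+ r)) by rewrite /B; ring.
  apply: ler_wpM2l; first exact: sqr_ge0.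
  apply: le_trans (hC r) _; apply: ler_wpM2l => //.
  rewrite -sg2 -exprM mulnC muln2 -addnn exprD; apply: ler_wpM2r; first by rewrite exprn_ge0 // ltW.
  by apply: ler_wiXn2l => //; rewrite ltW.
have D0 : 0 <= A * z + B * sg ^+ N0 by nneg.
rewrite (bigD1 ord0) //= expr0 mulr1 -[leRHS](subrK 1) addrC; apply: lerD; last first.
  by rewrite /bfac /sqrtpow fact0 expr0 !expr1n divr1.
apply: (@le_trans _ _ (\sum_(r < k.+2) (A * z + B * sg ^+ N0) * sg ^+ r)).
  rewrite [leRHS](bigID (fun r : 'I_k.+2 => (r <= L)%N && (r != ord0))) /= -[leLHS]addr0; apply: lerD.
    apply: ler_sum => r /andP[rL rn0]; apply: term => //.
    by rewrite lt0n.
  by apply: sumr_ge0 => r _; rewrite mulr_ge0 ?exprn_ge0 ?(ltW sg0).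
rewrite -(big_mkord xpredT (fun r => (A * z + B * sg ^+ N0) * sg ^+ r)).
apply: le_trans (geometric_tail_le _ _ D0 sg01) _.
rewrite expr0 mulr1 mulrDl.
have -> : t^-1 - 1 = d / 2 + d / 2 by rewrite /d; field; rewrite gt_eqF.
apply: lerD hN; rewrite ler_pdivrMr //.
apply: (@le_trans _ _ ((A + 1) * z0)); last by rewrite /z0 mulrC divfK // gt_eqF // ltr_wpDl.
by apply: ler_pM => //; rewrite lerDl.
Qed.

(** With y = e^2/(t sqrt n), the bound 1/t on the series cancels the t in y, and what remains is
    (n^n / (n! e^n))^2 <= 1: no exponential factor is lost. *)
Lemma spread_sum_le1 (t : R) : 0 < t < 1 -> exists K, forall k (L : nat), (K <= k)%N ->
  L%:R <= t ^+ 4 * k.+1%:R ->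
  \sum_(chi : {ffun 'I_k.+1 -> 'I_k.+1} | [forall c, (mult chi c <= L)%N]) `|fhat R chi| ^+ 3 <= 1.
Proof.
move=> t01; have [K hK] := spread_series_le t01; exists K => k L kK hL.
have /andP[t0 t1] := t01; have e0 := expR_gt0 (1 : R).
set s := Num.sqrt k.+1%:R : R.
have s0 : 0 < s by exact: sqn_gt0.
have y0 : 0 < e ^+ 2 / (t * s) by rewrite divr_gt0 ?exprn_gt0 ?mulr_gt0.
apply: le_trans (@spread_sum_le R k L _ y0) _.
have G := hK k L kK hL; rewrite -/s in G.
set G0 := \sum_(r < _ | _) _ in G *.
have G00 : 0 <= G0.
  by apply: sumr_ge0 => r _; rewrite mulr_ge0 ?bfac_ge0 // exprn_ge0 // ltW.
have h : (G0 / (e ^+ 2 / (t * s))) ^+ k.+1 <= (s / e ^+ 2) ^+ k.+1.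
  apply: lerXn2r; rewrite ?nnegrE ?divr_ge0 ?sqr_ge0 ?mulr_ge0 ?(ltW t0) ?(ltW s0) //.
  have -> : s / e ^+ 2 = t^-1 / (e ^+ 2 / (t * s)) by field; rewrite !gt_eqF.
  by rewrite ler_wpM2r // invr_ge0 ltW.
have K0 : 0 <= sqrtpow R k.+1 k.+1 ^+ 3 / (k.+1`!)%:R ^+ 2.
  by rewrite divr_ge0 ?exprn_ge0 ?(ltW (sqrtpow_gt0 _ _)).
apply: le_trans (ler_wpM2l K0 h) _.
have -> : sqrtpow R k.+1 k.+1 ^+ 3 / (k.+1`!)%:R ^+ 2 * (s / e ^+ 2) ^+ k.+1 =
   (k.+1%:R ^+ k.+1 / ((k.+1`!)%:R * expR k.+1%:R)) ^+ 2.
  have e2 : (e ^+ 2) ^+ k.+1 = expR k.+1%:R ^+ 2 by rewrite exprAC -[e ^+ k.+1]expRM_natl mulr1.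
  rewrite -sqrtpow_sqr (expr_div_n s) e2 -/(sqrtpow R k.+1 k.+1).
  move: (sqrtpow R k.+1 k.+1) (factR_neq0 R k.+1) (gt_eqF (expR_gt0 (k.+1%:R : R))) => a hb hc.
  by field; rewrite hb hc.
have pos : 0 < (k.+1`!)%:R * expR k.+1%:R :> R by rewrite mulr_gt0 ?expR_gt0 // ltr0n fact_gt0.
rewrite expr_le1 ?divr_ge0 ?exprn_ge0 ?(ltW pos) //.
by rewrite ler_pdivrMr ?mul1r ?fact_lower // mulr_gt0 ?expR_gt0 // ltr0n fact_gt0.
Qed.

End SpreadNegligible.

(** * Assembling the asymptotic formula *)

Lemma semiqueens_ratio (R : realType) k :
  (s k.+1)%:R / ((k.+1`!)%:R ^+ 3 / k.+1%:R ^+ k) =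
  (\sum_(chi : {ffun 'I_k.+1 -> 'I_k.+1}) fhat R chi ^+ 3) / k.+1%:R :> R.
Proof.
have n0 : k.+1%:R != 0 :> R by rewrite pnatr_eq0.
have f0 := factR_neq0 R k.+1.
have := sum_fhat3 R k; rewrite (exprS _ k).
have nk0 : k.+1%:R ^+ k != 0 :> R by rewrite expf_neq0.
move: (\sum_chi _) ((s k.+1)%:R : R) (k.+1%:R : R) n0 (k.+1%:R ^+ k : R) nk0 ((k.+1`!)%:R : R) f0.
move=> S x N N0 P P0 f f0 h.
have -> : S = N * P * x / f ^+ 3 by rewrite -h mulrAC divff ?mul1r // expf_neq0.
by field; rewrite f0 P0 N0.
Qed.

Lemma semiqueens_ratio_limit (R : realType) (eps : R) : 0 < eps ->
  exists K, forall k, (K <= k)%N -> ~~ odd k ->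
  `|(s k.+1)%:R / ((k.+1`!)%:R ^+ 3 / k.+1%:R ^+ k) - expR (- (1 / 2))| <= eps.
Proof.
move=> e0; have e2 : 0 < eps / 2 by rewrite divr_gt0.
have [K1 hK1] := sparse_sum_limit e2.
pose c := eta R ^+ 4.
have c0 : 0 < c by rewrite exprn_gt0 // /eta; lra.
have c2 : c < 1 / 2 by rewrite /c /eta; lra.
(* With t^4 = 1 - c, the inequality c n < M + 1 places the threshold n - (M + 1) below t^4 n, as
   [spread_sum_le1] requires. *)
pose t := Num.sqrt (Num.sqrt (1 - c)).
have d0 : 0 < 1 - c by rewrite subr_gt0; lra.
have t4 : t ^+ 4 = 1 - c by rewrite (exprM t 2 2) !sqr_sqrtr ?sqrtr_ge0 // ltW.
have t01 : 0 < t < 1.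
  have t0 : 0 < t by rewrite !sqrtr_gt0.
  rewrite t0 -(@ltr_pXn2r _ 4) ?nnegrE ?(ltW t0) // t4 expr1n.
  by rewrite ltrBlDr ltrDl.
have [K2 hK2] := spread_sum_le1 t01.
(* The last entry makes 1/n <= eps/2, since the part without a majority value is at most 1 before
   the division by n. *)
exists (maxn (maxn K1 K2) (Num.truncn (eps / 2)^-1)) => k.
rewrite !geq_max -andbA => /and3P[k1 k2 k3] even_k.
have nR : 0 < k.+1%:R :> R by rewrite ltr0n.
pose M := Num.truncn (c * k.+1%:R).
have cn0 : 0 <= c * k.+1%:R by rewrite mulr_ge0 // ltW.
have hM1 : M%:R <= c * k.+1%:R by rewrite truncn_le.
have hM2 : c * k.+1%:R < M.+1%:R by exact: truncnS_gt.
have M2 : (2 * M < k.+1)%N.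
  rewrite -(ltr_nat R) natrM; apply: (@le_lt_trans _ _ (2 * (c * k.+1%:R))).
    by rewrite ler_wpM2l.
  by rewrite mulrA -[ltRHS]mul1r ltr_pM2r //; lra.
rewrite semiqueens_ratio (majority_decomposition R even_k M2).
set S := \sum_(chi | _) _; set T := \sum_(m < M.+1) _.
have hT : `|T - expR (- (1 / 2))| <= eps / 2 by exact: hK1.
have hS : `|S / k.+1%:R| <= eps / 2.
  rewrite normrM normfV normr_nat ler_pdivrMr //.
  apply: (@le_trans _ _ 1).
    apply: le_trans (ler_norm_sum _ _ _) _.
    under eq_bigr => chi _ do rewrite normrX.
    apply: hK2 => //; rewrite t4 natrB; last by apply: leq_ltn_trans M2; rewrite leq_pmull.
    by rewrite mulrBl mul1r lerD2l lerN2 ltW.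
  rewrite mulrC -ler_pdivrMr // mul1r; apply: ltW.
  by apply: lt_le_trans (truncnS_gt _) _; rewrite ler_nat.
have -> : (S + k.+1%:R * T) / k.+1%:R - expR (- (1 / 2)) = S / k.+1%:R + (T - expR (- (1 / 2))).
  by field; rewrite nat1r gt_eqF.
apply: le_trans (ler_normD _ _) _.
by move: hS hT; lra.
Qed.

Local Open Scope classical_set_scope.
Local Open Scope ring_scope.

Theorem theorem1p2 (R : realType) :
  exists eps : nat -> R,
    (eps n @[n --> within [set n | odd n] \oo] --> (0 : R)) /\
    (forall n : nat, odd n ->
       (s n)%:R = (expR (- (1 / 2)) + eps n) * ((n`!)%:R ^+ 3 / n%:R ^+ (n - 1))).
Proof.
exists (fun n => (s n)%:R / ((n`!)%:R ^+ 3 / n%:R ^+ (n - 1)) - expR (- (1 / 2))); split.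
  apply/cvgrPdist_le => eps e0; have [K hK] := semiqueens_ratio_limit e0.
  rewrite near_withinE; exists K.+1 => //= n Kn odd_n.
  rewrite sub0r normrN; case: n Kn odd_n => // k Kk odd_n.
  by rewrite subSS subn0; apply: hK.
move=> n odd_n; rewrite addrC subrK divfK // mulf_neq0 ?invr_eq0 ?expf_neq0 ?factR_neq0 //.
by rewrite pnatr_eq0; case: n odd_n.
Qed.
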